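(* Let $n\ge 1$ and let $\sigma,\tau,\pi$ be elements of $\mathcal{D}_n$. Then $$\sum_{\substack{\sigma_1\in\mathcal{D}_n\\ \sigma\to\sigma_1}} t_{\sigma_1,\tau}^{\pi}\;=\;\sum_{\substack{\tau_1\in\mathcal{D}_n\\ \tau^*\to\tau_1^*}} t_{\sigma,\tau_1}^{\pi}.$$
   Context: **Words and diagrams.** $\mathcal{D}_n$ is the set of words $\sigma=\sigma_1\cdots\sigma_{2n}$ on the alphabet $\{0,1\}$ with $n$ zeros and $n$ ones such that each prefix contains at least as many $0$s as $1$s. A word is identified with a Ferrers diagram (English convention): its rows correspond to the letters $0$, the last $0$ giving the top row, and the row of a given $0$ has as many (left-justified) boxes as there are $1$s before this $0$. A word $\pi\in\mathcal D_n$ is also identified with the noncrossing perfect matching of $\{1,\dots,2n\}$ obtained by reading $0$ as an opening and $1$ as a closing parenthesis. The conjugate of $\sigma=\sigma_1\cdots\sigma_{2n}$ is $\sigma^*$ with $\sigma^*_i=1-\sigma_{2n+1-i}$. We write $\sigma\le\tau$ if the diagram of $\sigma$ is contained in that of $\tau$, and $\tau/\sigma$ is then the set of boxes of $\tau$ not in $\sigma$. We write $\sigma\to\tau$ if $\sigma\le\tau$ and $\tau/\sigma$ is a horizontal strip, i.e. has no two boxes in the same column (possibly $\sigma=\tau$). **The triangle.** $\mathcal{T}^n$ is the graph with vertices $(x,y)\in\mathbb{Z}^2$, $x\ge y\ge 0$, $x+y\le 4n-2$, with all unit horizontal and vertical edges between these vertices, together with $2n$ external (half-)edges: the $i$th one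 hangs vertically below the vertex $(2i-2,0)$, for $i=1,\dots,2n$. The left boundary vertices are $L_i=(i-1,i-1)$ and the right boundary vertices are $R_i=(2n-2+i,2n-i)$, $i=1,\dots,2n$ (so $L_{2n}=R_1$). **TFPL configurations.** For $\sigma,\tau,\pi\in\mathcal{D}_n$, $t_{\sigma,\tau}^\pi$ is the number of subgraphs (edge sets) $f$ of $\mathcal{T}^n$ such that: - all $2n$ external edges belong to $f$; - every vertex other than the $L_i$ and $R_i$ is incident to exactly two edges of $f$; - for $1\le i\le 2n-1$ the horizontal edge from $L_i$ to its right neighbour is in $f$; for $2\le i\le 2n$ the vertical edge just below $L_i$ is in $f$ if and only if $\sigma_i=0$; - for $2\le i\le 2n$ the horizontal edge from $R_i$ to its left neighbour is in $f$; for $1\le i\le 2n-1$ the vertical edge just below $R_i$ is in $f$ if and only if $\tau_i=1$; - the $n$ vertices $L_i$ with $\sigma_i=1$ are the starting points of $n$ paths of $f$ whose other endpoints are the $n$ vertices $R_j$ with $\tau_j=0$ (the path at the vertex $L_{2n}=R_1$ is reduced to this single vertex), and the external edges $i$ and $j$ are the two ends of the same path of $f$ if and only if $\{i,j\}$ is a pair of the matching $\pi$. Closed paths are allowed. *)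

(* Defs.v *)
From mathcomp Require Import all_boot.

Set Implicit Arguments.
Unset Strict Implicit.
Unset Printing Implicit Defensive.

(* The letters 0 and 1 are false and true.  All positions (of letters,        *)
(* boundary vertices, external edges) are counted from 0, so that the         *)
(* position i of the mathematical text is i - 1 here.                         *)

Definition balanced (w : seq bool) : bool :=
  (count_mem false w == count_mem true w) &&
  [forall k : 'I_(size w).+1,
     count_mem true (take k w) <= count_mem false (take k w)].

Definition dyck (n : nat) : {set n.*2.-tuple bool} :=
  [set w : n.*2.-tuple bool | balanced w].

Definition conjugate (n : nat) (w : n.*2.-tuple bool) : n.*2.-tuple bool :=
  [tuple of rev (map negb w)].

(* Row lengths of the Ferrers diagram, from top to bottom. *)
Definition rows (w : seq bool) : seq nat :=
  rev [seq count_mem true (take i w) | i <- iota 0 (size w) & ~~ nth true w i].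

(* The box (r, c) lies in row r and column c; a word with n zeros and n ones  *)
(* has n rows of length at most n.                                            *)
Definition diagram (n : nat) (w : n.*2.-tuple bool) : {set 'I_n * 'I_n} :=
  [set b : 'I_n * 'I_n | b.2 < nth 0 (rows w) b.1].

Definition horizontal_strip (n : nat) (S : {set 'I_n * 'I_n}) : bool :=
  [forall b in S, forall c in S, (b.2 == c.2) ==> (b == c)].

Definition arrow (n : nat) (s t : n.*2.-tuple bool) : bool :=
  (diagram s \subset diagram t) && horizontal_strip (diagram t :\: diagram s).

(* i < j, an opening parenthesis at i, a closing one at j, and a well         *)
(* parenthesized word strictly between them.                                  *)
Definition opens_closes (n : nat) (p : n.*2.-tuple bool) (i j : 'I_n.*2) :=
  [&& i < j, ~~ tnth p i, tnth p j & balanced (drop i.+1 (take j p))].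

Definition matched (n : nat) (p : n.*2.-tuple bool) (i j : 'I_n.*2) : bool :=
  opens_closes p i j || opens_closes p j i.

Definition triangle (n : nat) : seq (nat * nat) :=
  [seq v <- [seq (x, y) | x <- iota 0 (4 * n - 1), y <- iota 0 x.+1]
         | v.1 + v.2 <= 4 * n - 2].

Definition vertex (n : nat) : finType := seq_sub (triangle n).

Definition left_vertex (i : nat) : nat * nat := (i, i).

Definition right_vertex (n i : nat) : nat * nat :=
  (n.*2.-1 + i, n.*2.-1 - i).

(* inl v is the horizontal edge from v to its right neighbour; inr v is the   *)
(* vertical edge just below v, an external half-edge when v has ordinate 0.   *)
(* Not every such term is an edge of the triangle: see is_edge.               *)
Definition edge (n : nat) : finType := (vertex n + vertex n)%type.

Definition is_edge (n : nat) (e : edge n) : bool :=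
  match e with
  | inl v => ((val v).1.+1, (val v).2) \in triangle n
  | inr v => (0 < (val v).2) || ~~ odd (val v).1
  end.

(* An external half-edge has a single end. *)
Definition ends (n : nat) (e : edge n) : seq (nat * nat) :=
  match e with
  | inl v => [:: val v; ((val v).1.+1, (val v).2)]
  | inr v => if (val v).2 is y.+1 then [:: val v; ((val v).1, y)]
             else [:: val v]
  end.

Section Subgraph.

Variables (n : nat) (f : {set edge n}).

Definition horizontal_at (p : nat * nat) : bool :=
  [exists v : vertex n, (val v == p) && (inl v \in f)].

Definition vertical_below (p : nat * nat) : bool :=
  [exists v : vertex n, (val v == p) && (inr v \in f)].

Definition degree (v : vertex n) : nat :=
  #|[set e in f | val v \in ends e]|.

Definition adjacent (v w : vertex n) : bool :=
  (v != w) && [exists e in f, (val v \in ends e) && (val w \in ends e)].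

(* The vertices at p and q belong to the same component of f.  The conditions *)
(* of is_tfpl bound all degrees by 2, so the components are then closed paths *)
(* and paths; the ends of the latter are the external edges and the boundary  *)
(* vertices of degree 1, an isolated vertex being a path by itself.           *)
Definition joined (p q : nat * nat) : bool :=
  [exists v : vertex n, exists w : vertex n,
     [&& val v == p, val w == q & connect adjacent v w]].

Definition on_boundary (v : vertex n) : bool :=
  [exists i : 'I_n.*2, (val v == left_vertex i) || (val v == right_vertex n i)].

Definition is_tfpl (sigma tau pi : n.*2.-tuple bool) : bool :=
  [&& [forall e in f, is_edge e],
      [forall i : 'I_n.*2, vertical_below (i.*2, 0)],
      [forall v : vertex n, ~~ on_boundary v ==> (degree v == 2)],
      [forall i : 'I_n.*2,
         ((i < n.*2.-1) ==> horizontal_at (left_vertex i)) &&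
         ((0 < i) ==> (vertical_below (left_vertex i) == ~~ tnth sigma i))],
      (* the left neighbour of right_vertex n i is (n.*2.-1 + i).-1, n.*2.-1 - i *)
      [forall i : 'I_n.*2,
         ((0 < i) ==> horizontal_at ((right_vertex n i).1.-1,
                                     (right_vertex n i).2)) &&
         ((i < n.*2.-1) ==>
            (vertical_below (right_vertex n i) == tnth tau i))],
      [forall i : 'I_n.*2, tnth sigma i ==>
         [exists j : 'I_n.*2,
            ~~ tnth tau j && joined (left_vertex i) (right_vertex n j)]],
      [forall j : 'I_n.*2, ~~ tnth tau j ==>
         [exists i : 'I_n.*2,
            tnth sigma i && joined (left_vertex i) (right_vertex n j)]] &
      [forall i : 'I_n.*2, forall j : 'I_n.*2, (i != j) ==>
         (joined (i.*2, 0) (j.*2, 0) == matched pi i j)]].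

End Subgraph.

Definition tfpl_number (n : nat) (sigma tau pi : n.*2.-tuple bool) : nat :=
  #|[set f : {set edge n} | is_tfpl f sigma tau pi]|.

(* Main.v *)
(* Wieland drift.  Colour the unit cells of the square lattice like a         *)

(* Both sides count pairs of a boundary word and a configuration, and the drift injects the left
   pairs into the right ones. In the chessboard colouring every edge borders one active cell and
   every inner vertex is a corner of two, so gyration acts cell by cell and sends degree 2 to degree
   2 ([gyr_deg]). If each vertex having both its edges in one active cell is moved to the opposite
   corner, the images of adjacent vertices stay connected ([gyr_conn]). Vertices of degree at most 1
   do not move and gyration is an involution ([gyrK]), so connections between path ends can be
   carried forward and backward.

   [drift_spec] states that the drift is a configuration with left word [sigma]. On the left and
   bottom sides this is local. On the right it needs the path condition, which forbids a path from
   turning back between consecutive right boundary vertices ([no_right_turn]). Then the prefix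
   counts of the new right word exceed those of [tau] by 0 or 1, the excess being the value of one
   edge ([ones_drift_right]), which gives the arrow between the conjugates. That the new word is a
   Dyck word is seen in the mirror image: the paths starting low on the left boundary must cross an
   antidiagonal that has only as many edges as the word has zeros so far ([spec_balanced]).

   The gyrated configuration can be rebuilt from the drift and the two right words, so the drift is
   injective ([drift_inj]). Reflection bounds the right pairs by the left pairs of the conjugate
   data, and the inequalities close up to an equality. *)
(* chessboard.  Gyration exchanges edges and non-edges in every active cell,  *)
(* except in those having exactly two parallel edges.  It is an involution,   *)
(* turns the degree d of an inner vertex into 4 - d, and within each cell it  *)
(* preserves which corners of degree 1 are connected; hence paths keep their  *)
(* ends.  A configuration f with left boundary sigma1 is completed on the     *)
(* left by edges encoding the horizontal strip from sigma to sigma1.  After   *)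
(* gyration, the configuration seen through the triangle moved by one step to *)
(* the left has left boundary sigma, the same matching pi, and a right        *)
(* boundary tau1 with tau^* -> tau1^*.  The edges that are left out on the    *)
(* right are determined by tau and tau1, so that this map is injective, and   *)
(* the reflection in a vertical axis, which exchanges the roles of both       *)
(* sides, gives the opposite inequality.                                      *)
Require Import Defs.
From mathcomp Require Import all_boot.
From mathcomp Require Import zify.

Set Implicit Arguments.
Unset Strict Implicit.
Unset Printing Implicit Defensive.

(** * Walks in graphs of degree at most two *)

Section Walks.

Variables (T : eqType) (e : rel T).
Hypothesis e_sym : symmetric e.

Definition conn (p q : T) : Prop := exists2 s, path e p s & last p s = q.

Definition pendant (p : T) : Prop := forall x y, e p x -> e p y -> x = y.

Lemma conn_refl p : conn p p.
Proof. by exists [::]. Qed.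

Lemma conn1 p q : e p q -> conn p q.
Proof. by move=> pq; exists [:: q]; rewrite //= pq. Qed.

Lemma conn_trans q p r : conn p q -> conn q r -> conn p r.
Proof.
move=> [s ps <-] [t qt <-]; exists (s ++ t); last by rewrite last_cat.
by rewrite cat_path ps.
Qed.

Lemma conn_sym p q : conn p q -> conn q p.
Proof.
move=> [s]; elim: s p => [|x s IH] p /=; first by move=> _ ->; exact: conn_refl.
case/andP=> px /IH{}IH /IH h; apply: conn_trans h _.
by apply: conn1; rewrite e_sym.
Qed.

Lemma conn_ind_r (P : T -> Prop) p q :
  (forall x y, P x -> e x y -> P y) -> P p -> conn p q -> P q.
Proof.
move=> Pe Pp [s + <-]; elim: s p Pp => //= x s IH p Pp /andP[px].
by apply: IH; apply: Pe px.
Qed.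

Lemma conn_simple p q :
  conn p q -> exists2 s, path e p s /\ uniq (p :: s) & last p s = q.
Proof. by move=> [s /shortenP[t pt ut _] <-]; exists t. Qed.

Hypothesis deg2 : forall p x y z,
  e p x -> e p y -> e p z -> [\/ x = y, x = z | y = z].

(** With degrees at most two, a simple path has only one way to continue, so two of them leaving
    along the same edge stay together until a pendant vertex stops both. *)
Lemma simple_paths_same_end o p s t :
  e o p -> path e p s -> path e p t -> uniq [:: o, p & s] -> uniq [:: o, p & t] ->
  pendant (last p s) -> pendant (last p t) -> last p s = last p t.
Proof.
elim: s o p t => [|x s IH] o p [|y t] //= op.
- move=> _ /andP[py _] _ /andP[+ _] p_end.
  by rewrite (p_end o y) ?inE ?eqxx ?orbT // e_sym.
- move=> /andP[py _] _ /andP[+ _] _ _ p_end.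
  by rewrite (p_end o x) ?inE ?eqxx ?orbT // e_sym.
move=> /andP[px xs] /andP[py yt] us ut sP tP.
have po : e p o by rewrite e_sym.
have xy : x = y.
  case: (deg2 po px py) => // oE; [move: us|move: ut];
    by rewrite oE !inE eqxx orbT.
move: yt ut tP; rewrite -xy => xt ut tP.
by apply: (IH p x t) => //; [case/andP: us|case/andP: ut].
Qed.

(** A component of maximal degree two is a path or a cycle, hence has at most two ends. *)
Lemma three_pendants a b c :
  pendant a -> pendant b -> pendant c -> conn a b -> conn a c ->
  [\/ a = b, a = c | b = c].
Proof.
move=> aP bP cP /conn_simple[[|x s] [ps us] lb] /conn_simple[[|y t] [pt ut] lc];
  rewrite /= in lb lc.
- by constructor 1.
- by constructor 1.
- by constructor 2.
move: ps pt => /= /andP[ax xs] /andP[ay yt].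
have xy := aP _ _ ax ay; rewrite -xy in lc ay yt ut.
by constructor 3; rewrite -lb -lc; apply: (simple_paths_same_end ax);
   rewrite ?lb ?lc.
Qed.

End Walks.

(** * Deleting pendant vertices *)

Section PendantRemoval.

Variables (T : eqType) (e : rel T) (S : pred T).
Hypothesis e_sym : symmetric e.
Hypothesis S_pendant : forall p, p \in S -> pendant e p.

Definition avoiding : rel T := [rel x y | [&& x \notin S, y \notin S & e x y]].

(** A simple path can meet a pendant vertex only at its own ends. *)
Lemma conn_avoiding p q :
  p \notin S -> q \notin S -> conn e p q -> conn avoiding p q.
Proof.
move=> pS qS /(conn_simple)[s [ps us] lq]; exists s => //; rewrite -lq in qS.
case: s ps us qS {lq} => //= x s /andP[px xs] us lS.
suff [xS s_av] : x \notin S /\ path avoiding x s by rewrite /= s_av /avoiding /= pS xS px.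
elim: s p x px xs us lS {pS} => [|y s IH] p x px /=; first by [].
case/andP=> xy ys us lS.
have [yS s_av] : y \notin S /\ path avoiding y s.
  by apply: (IH x) => //; case/andP: us.
have xS : x \notin S.
  apply/negP => /S_pendant xP; move: us.
  by rewrite (xP p y) ?inE ?eqxx ?orbT //= e_sym.
by rewrite s_av /avoiding /= xS yS xy.
Qed.

End PendantRemoval.

Lemma conn_map (T T' : eqType) (e : rel T) (e' : rel T') (f : T -> T') :
  (forall x y, e x y -> conn e' (f x) (f y)) ->
  forall p q, conn e p q -> conn e' (f p) (f q).
Proof.
move=> fe p q; apply: (conn_ind_r (P := fun q => conn e' (f p) (f q))).
  by move=> x y px /fe; apply: conn_trans.
exact: conn_refl.
Qed.

(** * Gyration *)

(* [ver c x y] is the edge below [(x, y)], as in [edge]. *)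
Record config := Config {hor : nat -> nat -> bool; ver : nat -> nat -> bool}.

Definition adj (c : config) : rel (nat * nat) := fun p q =>
  [|| (q == (p.1.+1, p.2)) && hor c p.1 p.2,
      (p == (q.1.+1, q.2)) && hor c q.1 q.2,
      (q == (p.1, p.2.+1)) && ver c q.1 q.2
    | (p == (q.1, q.2.+1)) && ver c p.1 p.2].

Definition deg (c : config) (x y : nat) : nat :=
  hor c x y + ((0 < x) && hor c x.-1 y) + ver c x y + ver c x y.+1.

Lemma adj_sym c : symmetric (adj c).
Proof. by move=> p q; rewrite /adj; do 4!case: (_ && _). Qed.

Lemma adj_hor c x y : hor c x y -> adj c (x, y) (x.+1, y).
Proof. by rewrite /adj /= eqxx => ->. Qed.

Lemma adj_ver c x y : ver c x y.+1 -> adj c (x, y) (x, y.+1).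
Proof. by rewrite /adj /= eqxx => ->; rewrite !orbT. Qed.

Lemma adjW c (P : nat * nat -> nat * nat -> Prop) :
  (forall p q, P p q -> P q p) ->
  (forall x y, hor c x y -> P (x, y) (x.+1, y)) ->
  (forall x y, ver c x y.+1 -> P (x, y) (x, y.+1)) ->
  forall p q, adj c p q -> P p q.
Proof.
move=> Psym Ph Pv [x y] [x' y']; rewrite /adj /=.
by case/or4P=> /andP[/eqP[-> ->]] ?;
  [exact: Ph|apply/Psym/Ph|exact: Pv|apply/Psym/Pv].
Qed.

Definition nbrs c (p : nat * nat) : seq (nat * nat) :=
  let: (x, y) := p in
  nseq (hor c x y) (x.+1, y) ++ nseq ((0 < x) && hor c x.-1 y) (x.-1, y) ++
  nseq ((0 < y) && ver c x y) (x, y.-1) ++ nseq (ver c x y.+1) (x, y.+1).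

Lemma adj_nbrs c p q : adj c p q -> q \in nbrs c p.
Proof.
case: p q => [x y] [x' y']; rewrite /adj !mem_cat !mem_nseq /=.
case/or4P=> /andP[/eqP[-> ->] h]; rewrite ?h ?eqxx ?orbT //.
Qed.

(** An external half-edge counts in the degree but leads to no neighbour. *)
Lemma size_nbrs c x y : size (nbrs c (x, y)) + ((y == 0) && ver c x y) = deg c x y.
Proof. by rewrite !size_cat !size_nseq /deg; lia. Qed.

Lemma deg_adj2 c : (forall x y, deg c x y <= 2) ->
  forall p q r s, adj c p q -> adj c p r -> adj c p s ->
  [\/ q = r, q = s | r = s].
Proof.
move=> deg2 [x y] q r s pq pr ps; move: (deg2 x y) (size_nbrs c x y).
have [->|qr] := eqVneq q r; first by constructor 1.
have [->|qs] := eqVneq q s; first by constructor 2.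
have [->|rs] := eqVneq r s; first by constructor 3.
suff : 3 <= size (nbrs c (x, y)) by lia.
apply: (@uniq_leq_size _ [:: q; r; s]); first by rewrite /= !inE negb_or qr qs rs.
by move=> z; rewrite !inE => /or3P[] /eqP ->; exact: adj_nbrs.
Qed.

Lemma deg_pendant c x y :
  deg c x y <= 1 + ((y == 0) && ver c x y) -> pendant (adj c) (x, y).
Proof.
move=> d q r pq pr; apply/eqP/negP => qr; move: d (size_nbrs c x y).
suff : 2 <= size (nbrs c (x, y)) by lia.
apply: (@uniq_leq_size _ [:: q; r]); first by rewrite /= !inE; case: eqVneq qr.
by move=> z; rewrite !inE => /orP[] /eqP ->; exact: adj_nbrs.
Qed.

Section Gyration.

Variable n : nat.

(* The active cells: the unit squares with a lower left corner [(x, y)] such  *)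
(* that [reg x y].  A configuration f of the triangle sits in their union     *)
(* with its vertex (x, y) at [(x.+2, y.+1)], its drift with its vertex (x, y) *)
(* at [(x.+1, y.+1)].                                                         *)
Definition reg (x y : nat) : bool := [&& odd (x + y), y < x & x + y < 4 * n].

(** [regh] and [regv] single out the edges bordering an active cell; the parity of [x + y] tells on
    which side of the edge that cell lies. *)
Definition regh (x y : nat) : bool :=
  if odd (x + y) then reg x y else (0 < y) && reg x y.-1.

Definition regv (x y : nat) : bool :=
  (0 < y) && (if odd (x + y) then (0 < x) && reg x.-1 y.-1 else reg x y.-1).

Definition parallel (c : config) (x y : nat) : bool :=
  [&& hor c x y == hor c x y.+1, ver c x y.+1 == ver c x.+1 y.+1
    & hor c x y != ver c x y.+1].

(** Comparison with [parallel] keeps an edge of a parallel cell and complements any other. *)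
Definition gyr (c : config) : config :=
  Config
    (fun x y => regh x y &&
       (hor c x y == parallel c x (if odd (x + y) then y else y.-1)))
    (fun x y => regv x y &&
       (ver c x y == parallel c (if odd (x + y) then x.-1 else x) y.-1)).

Lemma gyr_cell c x y : reg x y ->
  [/\ hor (gyr c) x y = (hor c x y == parallel c x y),
      hor (gyr c) x y.+1 = (hor c x y.+1 == parallel c x y),
      ver (gyr c) x y.+1 = (ver c x y.+1 == parallel c x y)
    & ver (gyr c) x.+1 y.+1 = (ver c x.+1 y.+1 == parallel c x y)].
Proof.
move=> r; have /and3P[o _ _] := r; rewrite /= /regh /regv !addSn !addnS /=.
by rewrite negbK o /= r.
Qed.

Lemma parallel_gyr c x y : reg x y -> parallel (gyr c) x y = parallel c x y.
Proof.
move=> /(gyr_cell c)[b t l r]; rewrite {1}/parallel b t l r /parallel.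
by do 4!case: (_ c _ _).
Qed.

Definition supported (c : config) : Prop :=
  (forall x y, hor c x y -> regh x y) /\ (forall x y, ver c x y -> regv x y).

Lemma gyr_supported c : supported (gyr c).
Proof. by split=> x y /andP[]. Qed.

Lemma gyrK c : supported c ->
  hor (gyr (gyr c)) =2 hor c /\ ver (gyr (gyr c)) =2 ver c.
Proof.
move=> [sh sv]; split=> x y.
  case: (boolP (regh x y)) => [r0|]; last first.
    by move=> r0; rewrite [LHS]/= (negbTE r0); apply/esym/(contraNF (@sh x y)).
  have [z rz] : exists z, reg x z /\ (y = z \/ y = z.+1).
    by move: r0; rewrite /regh; case: odd => // r0; [exists y|exists y.-1];
       split; try lia; case/andP: r0.
  case: rz => rz zE; have [b t _ _] := gyr_cell (gyr c) rz.
  have [b' t' _ _] := gyr_cell c rz.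
  by case: zE => ->; rewrite ?b ?t parallel_gyr // ?b' ?t'; do 2!case: (_ c _ _).
case: (boolP (regv x y)) => [r0|]; last first.
  by move=> r0; rewrite [LHS]/= (negbTE r0); apply/esym/(contraNF (@sv x y)).
have [w [z [rwz -> wE]]] : exists w z, [/\ reg w z, y = z.+1 & (x = w \/ x = w.+1)].
  move: r0; rewrite /regv => /andP[y0]; case: odd => [/andP[x0 r0]|r0].
    by exists x.-1, y.-1; split=> //; lia.
  by exists x, y.-1; split=> //; lia.
have [_ _ l r] := gyr_cell (gyr c) rwz; have [_ _ l' r'] := gyr_cell c rwz.
by case: wE => ->; rewrite ?l ?r parallel_gyr // ?l' ?r'; do 2!case: (_ c _ _).
Qed.

Definition inner (x y : nat) : bool := [&& 0 < y, y < x & x + y <= 4 * n].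

(** The vertex is a common corner of two active cells, with two possible edges in each. A
    complemented cell turns k of them into 2 - k; in a parallel cell k = 1 at every corner, so
    keeping the edges has the same effect. *)
Lemma gyr_deg c x y : inner x y -> deg (gyr c) x y + deg c x y = 4.
Proof.
case: x y => [|x] [|y] // xy; rewrite /deg.
case o: (odd (x + y)).
  have r1 : reg x y by rewrite /reg o; move: xy; rewrite /inner; lia.
  have r2 : reg x.+1 y.+1.
    by move: xy; rewrite /reg /inner addSn addnS /= o; lia.
  have [_ t _ r] := gyr_cell c r1; have [b _ l _] := gyr_cell c r2.
  rewrite b t l r /parallel !succnK ltn0Sn /= ; do 8!case: (_ c _ _) => //=.
have r1 : reg x y.+1 by move: xy o; rewrite /reg /inner; lia.
have r2 : reg x.+1 y by move: xy o; rewrite /reg /inner; lia.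
have [b _ _ r] := gyr_cell c r1; have [_ t l _] := gyr_cell c r2.
rewrite b t l r /parallel !succnK ltn0Sn /=.
do 8!case: (_ c _ _) => //=.
Qed.

(** A vertex that is not inner touches at most one active cell. *)
Lemma supported_deg c x y : supported c -> ~~ inner x y -> deg c x y <= 2.
Proof.
move=> [sh sv]; rewrite /inner /deg.
move/implyP: (sh x y); move/implyP: (sh x.-1 y); move/implyP: (sv x y).
move/implyP: (sv x y.+1); rewrite /regh /regv /reg.
do 4!case: (_ c _ _); do ?case: ifP; lia.
Qed.

End Gyration.

(** * Gyration preserves connections *)

Section GyrationPaths.

Variables (n : nat) (c : config).

(* A vertex [p] on two edges of one active cell is left by all its edges; the *)
(* opposite corner then lies on the new path through that cell.  A closed     *)
(* path around a cell disappears, and is sent to a single point.              *)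
Definition gyr_pt (p : nat * nat) : nat * nat :=
  let: (x, y) := p in
  if odd (x + y) then
    if hor c x y && ver c x y.+1 then
      if hor c x y.+1 && ver c x.+1 y.+1 then (x, y) else (x.+1, y.+1)
    else if [&& 0 < x, hor c x.-1 y & ver c x y] then (x.-1, y.-1) else p
  else
    if [&& 0 < x, hor c x.-1 y & ver c x y.+1] then
      if hor c x.-1 y.+1 && ver c x.-1 y.+1 then (x.-1, y) else (x.-1, y.+1)
    else if hor c x y && ver c x y then
      if hor c x y.-1 && ver c x.+1 y then (x, y.-1) else (x.+1, y.-1)
    else p.

Lemma gyr_pt_id x y : deg c x y <= 1 -> gyr_pt (x, y) = (x, y).
Proof.
rewrite /deg /gyr_pt.
case: odd; case: (hor c x y); case: (0 < x); case: (hor c x.-1 y);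
  case: (ver c x y); case: (ver c x y.+1) => //=; lia.
Qed.

Hypothesis deg2 : forall x y, deg c x y <= 2.

Section Cell.

Variables (x y : nat).
Hypothesis rxy : reg n x y.
Let b := hor c x y.
Let t := hor c x y.+1.
Let l := ver c x y.+1.
Let r := ver c x.+1 y.+1.

Let o : odd (x + y).
Proof. by case/and3P: rxy. Qed.

(** A corner with an edge in this cell cannot have both edges in its other active cell, by the
    degree bound; its image is therefore decided here. The same holds for the other three
    corners. *)
Lemma gyr_pt_bl : b || l -> gyr_pt (x, y) =
  if b && l then if t && r then (x, y) else (x.+1, y.+1) else (x, y).
Proof.
rewrite /gyr_pt o -/b -/l -/t -/r; have := deg2 x y; rewrite /deg -/b -/l.
case: b; case: l; case: (0 < x); case: (hor c x.-1 y); case: (ver c x y) => //=; lia.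
Qed.

Lemma gyr_pt_tr : t || r -> gyr_pt (x.+1, y.+1) =
  if t && r then (x, y) else (x.+1, y.+1).
Proof.
rewrite /gyr_pt addSn addnS /= o -/t -/r; have := deg2 x.+1 y.+1.
rewrite /deg /= -/t -/r.
case: t; case: r; case: (hor c x.+1 y.+1); case: (ver c x.+1 y.+2) => //=; lia.
Qed.

Lemma gyr_pt_br : b || r -> gyr_pt (x.+1, y) =
  if b && r then if t && l then (x, y) else (x, y.+1) else (x.+1, y).
Proof.
rewrite /gyr_pt addSn /= o -/b -/l -/t -/r; have := deg2 x.+1 y.
rewrite /deg /= -/b -/r.
case: b; case: r; case: (hor c x.+1 y); case: (ver c x.+1 y) => //=; lia.
Qed.

Lemma gyr_pt_tl : t || l -> gyr_pt (x, y.+1) =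
  if t && l then if b && r then (x, y) else (x.+1, y) else (x, y.+1).
Proof.
rewrite /gyr_pt addnS /= o -/b -/l -/t -/r; have := deg2 x y.+1.
rewrite /deg -/t -/l.
case: t; case: l; case: (0 < x); case: (hor c x.-1 y.+1); case: (ver c x y.+2) => //=; lia.
Qed.

(** A check of the sixteen edge sets of a cell. For instance, three sides are replaced by the
    fourth, whose ends are the images of all four corners. *)
Lemma gyr_pt_edges :
  [/\ b -> conn (adj (gyr n c)) (gyr_pt (x, y)) (gyr_pt (x.+1, y)),
      t -> conn (adj (gyr n c)) (gyr_pt (x, y.+1)) (gyr_pt (x.+1, y.+1)),
      l -> conn (adj (gyr n c)) (gyr_pt (x, y)) (gyr_pt (x, y.+1))
    & r -> conn (adj (gyr n c)) (gyr_pt (x.+1, y)) (gyr_pt (x.+1, y.+1))].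
Proof.
have [hb ht hl hr] := gyr_cell c rxy; rewrite /parallel -/b -/t -/l -/r in hb ht hl hr.
have S := @conn_sym _ _ (@adj_sym (gyr n c)).
have C p q : adj (gyr n c) p q -> conn (adj (gyr n c)) p q by exact: conn1.
have Hb : hor (gyr n c) x y -> conn (adj (gyr n c)) (x, y) (x.+1, y).
  by move=> h; apply/C/adj_hor.
have Ht : hor (gyr n c) x y.+1 -> conn (adj (gyr n c)) (x, y.+1) (x.+1, y.+1).
  by move=> h; apply/C/adj_hor.
have Hl : ver (gyr n c) x y.+1 -> conn (adj (gyr n c)) (x, y) (x, y.+1).
  by move=> h; apply/C/adj_ver.
have Hr : ver (gyr n c) x.+1 y.+1 -> conn (adj (gyr n c)) (x.+1, y) (x.+1, y.+1).
  by move=> h; apply/C/adj_ver.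
have T := @conn_trans _ (adj (gyr n c)).
have R := @conn_refl _ (adj (gyr n c)).
move: Hb Ht Hl Hr gyr_pt_bl gyr_pt_tr gyr_pt_br gyr_pt_tl.
rewrite hb ht hl hr.
case: b; case: t; case: l; case: r => /= Hb Ht Hl Hr pbl ptr pbr ptl;
  do ?[have {}Hb := Hb isT]; do ?[have {}Ht := Ht isT];
  do ?[have {}Hl := Hl isT]; do ?[have {}Hr := Hr isT];
  do ?[have {}pbl := pbl isT]; do ?[have {}ptr := ptr isT];
  do ?[have {}pbr := pbr isT]; do ?[have {}ptl := ptl isT];
  split=> // _; rewrite ?pbl ?ptr ?pbr ?ptl //; eauto 4.
Qed.

End Cell.

Lemma gyr_conn p q : supported n c -> conn (adj c) p q ->
  conn (adj (gyr n c)) (gyr_pt p) (gyr_pt q).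
Proof.
move=> [sh sv]; apply: conn_map; apply: adjW => [p1 q1|x y h|x y h].
- exact: (conn_sym (@adj_sym _)).
- move: (sh _ _ h); rewrite /regh; case: odd => [/gyr_pt_edges[] /(_ h)//|].
  by case: y h => //= y h /gyr_pt_edges[_ /(_ h)].
move: (sv _ _ h); rewrite /regv addnS /=; case: ifP => [_|_ /gyr_pt_edges[_ _ /(_ h)]//].
by case: x h => //= x h /gyr_pt_edges[_ _ _ /(_ h)].
Qed.

End GyrationPaths.

(** * Configurations as edge sets *)

Definition tri (n x y : nat) : bool := (y <= x) && (x + y <= 4 * n - 2).

Section Interface.

Variable n : nat.
Hypothesis n_gt0 : 0 < n.

Lemma mem_triangle x y : ((x, y) \in triangle n) = tri n x y.
Proof.
rewrite mem_filter /tri; apply/andP/andP => [[xy]|[yx xy]].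
  move/allpairsPdep=> [x' [y' [_ y'x' xyE]]]; move: y'x' xyE xy.
  by rewrite mem_iota => y'x' [-> ->] /= xy; split; lia.
split=> //; apply/allpairsPdep; exists x, y; rewrite !mem_iota; split=> //; lia.
Qed.

Lemma valV (v : vertex n) : val v \in triangle n.
Proof. exact: valP. Qed.

Lemma triV (v : vertex n) : tri n (val v).1 (val v).2.
Proof. by rewrite -mem_triangle -surjective_pairing valV. Qed.

Definition vtx x y (h : tri n x y) : vertex n :=
  SeqSub (etrans (mem_triangle x y) h).

Definition config_of (f : {set edge n}) : config :=
  Config (fun x y => horizontal_at f (x, y)) (fun x y => vertical_below f (x, y)).

Definition edge_set (c : config) : {set edge n} :=
  [set e | is_edge e && match e with
                        | inl v => hor c (val v).1 (val v).2
                        | inr v => ver c (val v).1 (val v).2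
                        end].

Lemma exists_vertex (p : nat * nat) (Q : pred (vertex n)) (v : vertex n) :
  val v = p -> [exists u : vertex n, (val u == p) && Q u] = Q v.
Proof.
move=> vp; apply/existsP/idP => [[u /andP[/eqP up]]|Qv]; last first.
  by exists v; rewrite vp eqxx.
by have -> : u = v by apply: val_inj; rewrite up vp.
Qed.

Lemma exists_vertexF (p : nat * nat) (Q : pred (vertex n)) :
  p \notin triangle n -> [exists u : vertex n, (val u == p) && Q u] = false.
Proof.
by move=> pP; apply/existsP => -[u /andP[/eqP up _]]; rewrite -up valV in pP.
Qed.

Lemma hor_config_of f (v : vertex n) :
  hor (config_of f) (val v).1 (val v).2 = (inl v \in f).
Proof. by apply: exists_vertex; case: (val v). Qed.

Lemma ver_config_of f (v : vertex n) :
  ver (config_of f) (val v).1 (val v).2 = (inr v \in f).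
Proof. by apply: (@exists_vertex _ (fun u => inr u \in f)); case: (val v). Qed.

Definition has_hor x y := tri n x y && tri n x.+1 y.
Definition has_ver x y := tri n x y && ((0 < y) || ~~ odd x).

Definition edges_in (c : config) : Prop :=
  (forall x y, hor c x y -> has_hor x y) /\ (forall x y, ver c x y -> has_ver x y).

Lemma edges_in_config_of (f : {set edge n}) :
  {in f, forall e, is_edge e} -> edges_in (config_of f).
Proof.
move=> fE; split=> x y /existsP[v /andP[/eqP vE /fE]];
  have := triV v; rewrite /= vE /= ?mem_triangle /has_hor /has_ver.
  by move=> -> ->.
by move=> -> ->.
Qed.

Lemma edge_set_edges c : {in edge_set c, forall e, is_edge e}.
Proof. by move=> e; rewrite inE => /andP[]. Qed.

Lemma config_of_edge_set c x y :
  hor (config_of (edge_set c)) x y = has_hor x y && hor c x y /\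
  ver (config_of (edge_set c)) x y = has_ver x y && ver c x y.
Proof.
rewrite /has_hor /has_ver; case: (boolP (tri n x y)) => [xy|xyF].
  have [E1 E2] := (hor_config_of (edge_set c) (vtx xy), ver_config_of (edge_set c) (vtx xy)).
  by rewrite /= in E1 E2; rewrite /= E1 E2 !inE /= mem_triangle.
by split; apply: exists_vertexF; rewrite mem_triangle.
Qed.

Lemma config_of_inj (f g : {set edge n}) :
  hor (config_of f) =2 hor (config_of g) -> ver (config_of f) =2 ver (config_of g) ->
  f = g.
Proof.
move=> Eh Ev; apply/setP => -[v|v].
  by rewrite -!hor_config_of Eh.
by rewrite -!ver_config_of Ev.
Qed.

Lemma sum_vertex (p : nat * nat) (Q : pred (vertex n)) :
  \sum_(u : vertex n) ((val u == p) && Q u : nat) =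
  [exists u : vertex n, (val u == p) && Q u].
Proof.
case: (boolP (p \in triangle n)) => [pT|pF]; last first.
  rewrite exists_vertexF // big1 // => u _.
  by case: eqP => // up; rewrite -up valV in pF.
rewrite (@exists_vertex p Q (SeqSub pT)) // (bigD1 (SeqSub pT)) //= eqxx.
rewrite big1 ?addn0 // => u uE; case: eqP => // up.
by case/eqP: uE; apply: val_inj.
Qed.

Lemma mem_ends_hor (p : nat * nat) (u : vertex n) :
  (p \in ends (inl u)) = (val u == p) || ((val u == (p.1.-1, p.2)) && (0 < p.1)).
Proof.
rewrite !inE; case: p (val u) => [x y] [a b] /=; rewrite !xpair_eqE; lia.
Qed.

Lemma mem_ends_ver (p : nat * nat) (u : vertex n) :
  (p \in ends (inr u)) = (val u == p) || (val u == (p.1, p.2.+1)).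
Proof.
rewrite /ends; case: p (val u) => [x y] [a [|b]] /=; rewrite !inE !xpair_eqE /=; lia.
Qed.

Lemma degree_config_of (f : {set edge n}) (v : vertex n) :
  degree f v = deg (config_of f) (val v).1 (val v).2.
Proof.
rewrite /degree -sum1_card big_mkcond big_sumType /deg -!addnA addnA.
case: (val v) => [x y] /=.
have -> : (0 < x) && horizontal_at f (x.-1, y) =
    [exists u : vertex n, (val u == (x.-1, y)) && ((0 < x) && (inl u \in f))].
  by case: (0 < x) => //=; apply/esym/existsP => -[u]; rewrite andbF.
rewrite -!sum_vertex; congr (_ + _); rewrite -big_split; apply: eq_bigr => u _.
  rewrite inE mem_ends_hor; case: (inl u \in f); case: (val u) => [a b];
    rewrite !xpair_eqE /=; do ?case: ifP; lia.
rewrite inE mem_ends_ver; case: (inr u \in f); case: (val u) => [a b];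
  rewrite !xpair_eqE /=; do ?case: ifP; lia.
Qed.

Lemma adjacent_config_of (f : {set edge n}) (v w : vertex n) :
  adjacent f v w = adj (config_of f) (val v) (val w).
Proof.
have valE (a b : vertex n) : (a == b) = (val a == val b) by [].
apply/idP/idP => [/andP[vw /existsP[e /and3P[ef + +]]]|].
  move: vw; rewrite valE; move: (val v) (val w) => p q; case: e ef => u uf pq.
    have := hor_config_of f u; rewrite uf !inE.
    case: (val u) => [a b] h; have {}h : hor (config_of f) a b by [].
    case/orP=> /eqP pE; case/orP=> /eqP qE; move: pq; rewrite pE qE ?eqxx // => _.
      exact: adj_hor.
    by rewrite adj_sym; apply: adj_hor.
  have := ver_config_of f u; rewrite uf /ends.
  case: (val u) => [a [|b]] h; rewrite !inE.
    by move=> /eqP pE /eqP qE; move: pq; rewrite pE qE eqxx.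
  have {}h : ver (config_of f) a b.+1 by [].
  case/orP=> /eqP pE; case/orP=> /eqP qE; move: pq; rewrite pE qE ?eqxx // => _.
    by rewrite adj_sym; apply: adj_ver.
  exact: adj_ver.
rewrite /adjacent valE.
case Ev: (val v) => [x y]; case Ew: (val w) => [x' y']; rewrite /adj /=.
case/or4P=> /andP[/eqP[-> ->]] /existsP[u /andP[/eqP uE uf]];
  (apply/andP; split; [rewrite xpair_eqE; lia|apply/existsP]).
- by exists (inl u); rewrite uf /= uE !inE !eqxx !orbT.
- by exists (inl u); rewrite uf /= uE !inE !eqxx !orbT.
- by exists (inr u); rewrite uf /= uE !inE !eqxx !orbT.
- by exists (inr u); rewrite uf /= uE !inE !eqxx !orbT.
Qed.

Lemma joinedP (f : {set edge n}) (p q : nat * nat) :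
  {in f, forall e, is_edge e} -> p \in triangle n ->
  (joined f p q <-> conn (adj (config_of f)) p q).
Proof.
move=> fE pT; split.
  case/existsP=> v /existsP[w /and3P[/eqP <- /eqP <- /connectP[s vs ->]]].
  exists (map val s); last by rewrite last_map.
  rewrite path_map; apply: sub_path vs => a b.
  by rewrite adjacent_config_of.
case=> s; elim: s p pT => [|r s IH] p pT /=.
  move=> _ <-; apply/existsP; exists (SeqSub pT); apply/existsP; exists (SeqSub pT).
  by rewrite /= eqxx connect0.
case/andP=> pr rs lq; have [hT vT] := edges_in_config_of fE.
have rT : r \in triangle n.
  move: pr; case: (p) (r) => [a b] [a' b']; rewrite mem_triangle /adj /=.
  move: (hT a b) (hT a' b') (vT a' b') (vT a b); rewrite /has_hor /has_ver /tri.
  move=> h1 h2 h3 h4; case/or4P=> /andP[/eqP[]] => [-> ->|ax ay|ax ay|ax ay].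
  - by move/h1/andP=> [].
  - by move/h2/andP=> [].
  - by move/h3/andP=> [].
  - by move/h4; lia.
case/existsP: (IH _ rT rs lq) => v /existsP[w /and3P[vr wq vw]].
apply/existsP; exists (SeqSub pT); apply/existsP; exists w.
rewrite eqxx wq /=; apply: connect_trans vw; apply: connect1.
by rewrite adjacent_config_of (eqP vr).
Qed.

End Interface.

(** [is_tfpl] in terms of edge predicates on all pairs of naturals, so that shifts, reflection and
    gyration need no proofs of membership in the triangle. *)
Record tfpl_spec (n : nat) (c : config) (sigma tau : seq bool)
    (pi : n.*2.-tuple bool) : Prop := TfplSpec {
  spec_edges : edges_in n c;
  spec_external : forall i, i < n.*2 -> ver c i.*2 0;
  spec_degree : forall x y, y < x -> x + y < 4 * n - 2 -> deg c x y = 2;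
  spec_left_hor : forall i, i < n.*2.-1 -> hor c i i;
  spec_left_ver : forall i, 0 < i < n.*2 -> ver c i i = ~~ nth false sigma i;
  spec_right_hor : forall j, 0 < j < n.*2 -> hor c (n.*2.-1 + j).-1 (n.*2.-1 - j);
  spec_right_ver : forall j, j < n.*2.-1 ->
    ver c (n.*2.-1 + j) (n.*2.-1 - j) = nth false tau j;
  spec_left_path : forall i, i < n.*2 -> nth false sigma i ->
    exists j, [/\ j < n.*2, ~~ nth false tau j
                & conn (adj c) (left_vertex i) (right_vertex n j)];
  spec_right_path : forall j, j < n.*2 -> ~~ nth false tau j ->
    exists i, [/\ i < n.*2, nth false sigma i
                & conn (adj c) (left_vertex i) (right_vertex n j)];
  spec_matching : forall i j : 'I_n.*2, i != j ->
    (conn (adj c) (i.*2, 0) (j.*2, 0) <-> matched pi i j)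
}.

Section Spec.

Variables (n : nat) (f : {set edge n}) (sigma tau pi : n.*2.-tuple bool).
Hypothesis n_gt0 : 0 < n.

Lemma left_vertex_tri i : i < n.*2 -> left_vertex i \in triangle n.
Proof. by move=> i_lt; rewrite mem_triangle // /tri; lia. Qed.

Lemma ext_tri i : i < n.*2 -> (i.*2, 0) \in triangle n.
Proof. by move=> i_lt; rewrite mem_triangle // /tri; lia. Qed.

Lemma on_boundary_tri (v : vertex n) :
  on_boundary v = ((val v).1 == (val v).2) || ((val v).1 + (val v).2 == 4 * n - 2).
Proof.
have := triV n_gt0 v; rewrite /on_boundary; case: (val v) => [x y] /= xy.
apply/existsP/idP => [[i]|].
  by have := ltn_ord i; rewrite !xpair_eqE; lia.
have xn : x - n.*2.-1 < n.*2 by move: xy; rewrite /tri; lia.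
have yn : y < n.*2 by move: xy; rewrite /tri; lia.
move: xy; rewrite /tri => xy; case: (eqVneq x y) => [xE _|xE /= yE].
  by exists (Ordinal yn); rewrite /left_vertex /= xE eqxx.
by exists (Ordinal xn); rewrite !xpair_eqE /=; lia.
Qed.

Lemma tfplP : is_tfpl f sigma tau pi <->
  {in f, forall e, is_edge e} /\ tfpl_spec (config_of f) sigma tau pi.
Proof.
have tnthE (w : n.*2.-tuple bool) (i : 'I_n.*2) : tnth w i = nth false w i.
  exact: tnth_nth.
split.
  case/and5P=> /forallP f1 /forallP f2 /forallP f3 /forallP f4.
  case/and4P=> /forallP f5 /forallP f6 /forallP f7 /forallP f8.
  have fE : {in f, forall e, is_edge e} by move=> e; apply/implyP/f1.
  split=> //; split.
  - exact: edges_in_config_of.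
  - by move=> i i_lt; apply: (f2 (Ordinal i_lt)).
  - move=> x y yx xy.
    have xyT : tri n x y by rewrite /tri; lia.
    have := f3 (vtx n_gt0 xyT).
    rewrite (degree_config_of n_gt0) on_boundary_tri /=.
    by move=> h; apply/eqP; move: h; have -> : (x == y) || (x + y == 4 * n - 2) = false by lia.
  - move=> i i_lt; have i_lt2 : i < n.*2 by lia.
    by have /andP[/implyP + _] := f4 (Ordinal i_lt2); apply.
  - move=> i /andP[i0 i_lt]; have /andP[_ /implyP] := f4 (Ordinal i_lt).
    by rewrite tnthE => /(_ i0)/eqP.
  - move=> i /andP[i0 i_lt]; have /andP[/implyP + _] := f5 (Ordinal i_lt).
    by apply.
  - move=> i i_lt; have i_lt2 : i < n.*2 by lia.
    have /andP[_ /implyP] := f5 (Ordinal i_lt2).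
    by rewrite tnthE => /(_ i_lt)/eqP.
  - move=> i i_lt si; have := f6 (Ordinal i_lt); rewrite tnthE /= si /=.
    case/existsP=> j /andP[tj /joinedP] => /(_ n_gt0 fE (left_vertex_tri i_lt)) ij.
    by exists j; rewrite -tnthE; split.
  - move=> j j_lt tj; have := f7 (Ordinal j_lt); rewrite tnthE /= tj /=.
    case/existsP=> i /andP[si /joinedP].
    move=> /(_ n_gt0 fE (left_vertex_tri (ltn_ord i))) ij.
    by exists i; rewrite -tnthE; split.
  - move=> i j ij; have /forallP/(_ j)/implyP/(_ ij)/eqP <- := f8 i.
    apply: iff_sym; apply: (joinedP n_gt0 _ fE); exact: ext_tri.
case=> fE [_ f2 f3 f4h f4v f5h f5v f6 f7 f8].
apply/and5P; split; [| | | |apply/and4P; split]; apply/forallP.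
- by move=> e; apply/implyP/fE.
- by move=> i; apply: (f2 _ (ltn_ord i)).
- move=> v; apply/implyP; rewrite on_boundary_tri (degree_config_of n_gt0) => vB.
  have := triV n_gt0 v; rewrite /tri => vT; apply/eqP/f3; lia.
- move=> i; apply/andP; split; apply/implyP => h; first exact: f4h.
  by rewrite tnthE -f4v ?h ?ltn_ord.
- move=> i; apply/andP; split; apply/implyP => h; first by apply: f5h; rewrite h ltn_ord.
  by rewrite tnthE -f5v.
- move=> i; apply/implyP; rewrite tnthE => /(f6 _ (ltn_ord i))[j [j_lt tj ij]].
  apply/existsP; exists (Ordinal j_lt); rewrite tnthE tj /=.
  by apply/joinedP => //; apply: left_vertex_tri.
- move=> j; apply/implyP; rewrite tnthE => /(f7 _ (ltn_ord j))[i [i_lt si ij]].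
  apply/existsP; exists (Ordinal i_lt); rewrite tnthE si /=.
  by apply/joinedP => //; apply: left_vertex_tri.
- move=> i; apply/forallP => j; apply/implyP => /f8 ij; apply/eqP; apply/idP/idP.
    by move/joinedP=> /(_ n_gt0 fE (ext_tri (ltn_ord i)))/ij.
  by move/ij=> h; apply/joinedP => //; apply: ext_tri.
Qed.

End Spec.

(** * Reflection in a vertical axis *)

Definition ones (w : seq bool) (i : nat) : nat := count_mem true (take i w).

Lemma count_false_true (w : seq bool) :
  count_mem false w + count_mem true w = size w.
Proof. by rewrite -(count_predC (pred1 false)); congr (_ + _); apply: eq_count; case. Qed.

Lemma ones_le w i : i <= size w -> ones w i <= i.
Proof. by move=> i_le; rewrite /ones -{2}(size_takel i_le) count_size. Qed.

Lemma onesS w i : i < size w -> ones w i.+1 = ones w i + nth false w i.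
Proof.
move=> i_lt; rewrite /ones (take_nth false) // -cats1 count_cat /= addn0.
by case: nth.
Qed.

Lemma ones0 w : ones w 0 = 0.
Proof. by rewrite /ones take0. Qed.

Lemma balancedP w :
  reflect ((ones w (size w)).*2 = size w /\ forall k, k <= size w -> (ones w k).*2 <= k)
          (balanced w).
Proof.
have cF k : k <= size w -> count_mem false (take k w) = k - ones w k.
  move=> k_le; have := count_false_true (take k w); rewrite size_takel //.
  by rewrite /ones; lia.
have := count_false_true w; have onesE : ones w (size w) = count_mem true w.
  by rewrite /ones take_size.
move=> sw; apply: (iffP andP) => [[/eqP e /forallP pre]|[e pre]].
  split=> [|k k_le]; first by lia.
  have k_lt : k < (size w).+1 by [].
  by have := pre (Ordinal k_lt); rewrite /= cF // -/(ones w k); have := ones_le k_le; lia.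
split; first by apply/eqP; lia.
apply/forallP => k; rewrite cF; last by have := ltn_ord k.
by rewrite -/(ones w k); have := pre k; have := ltn_ord k; have := @ones_le w k; lia.
Qed.

(** The first [i] letters of the conjugate are the complements of the last [i] letters of [w]. *)
Lemma ones_rev_negb w i : i <= size w ->
  ones (rev (map negb w)) i + ones w (size w) = i + ones w (size w - i).
Proof.
move=> i_le.
have -> : ones (rev (map negb w)) i = count_mem false (drop (size w - i) w).
  rewrite /ones take_rev count_rev size_map -map_drop count_map.
  by apply: eq_count; case.
have := count_false_true (drop (size w - i) w).
have -> : ones w (size w) = ones w (size w - i) + count_mem true (drop (size w - i) w).
  by rewrite /ones take_size -count_cat cat_take_drop.
by rewrite size_drop; lia.
Qed.

Lemma balanced_rev_negb w : balanced (rev (map negb w)) = balanced w.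
Proof.
suff h u : balanced u -> balanced (rev (map negb u)).
  apply/idP/idP => [/h|/h //].
  by rewrite map_rev revK mapK //; exact: negbK.
case/balancedP=> e pre; apply/balancedP; rewrite size_rev size_map; split.
  by have := ones_rev_negb (leqnn (size u)); rewrite subnn ones0; lia.
move=> k k_le; have := ones_rev_negb k_le.
by have := pre (size u - k) (leq_subr _ _); lia.
Qed.

Section Conjugate.

Variable n : nat.
Implicit Types w p : n.*2.-tuple bool.

Lemma nth_conjugate w i : i < n.*2 ->
  nth false (conjugate w) i = ~~ nth false w (n.*2.-1 - i).
Proof.
move=> i_lt; rewrite /= nth_rev size_map size_tuple // (nth_map false) ?size_tuple; last by lia.
by congr (~~ nth _ _ _); lia.
Qed.

Lemma conjugateK : involutive (@conjugate n).
Proof. by move=> w; apply: val_inj; rewrite /= map_rev revK mapK //; exact: negbK. Qed.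

Lemma conjugate_dyck w : (conjugate w \in dyck n) = (w \in dyck n).
Proof. by rewrite !inE balanced_rev_negb. Qed.

Lemma opens_closes_conjugate p (i j : 'I_n.*2) :
  opens_closes (conjugate p) i j = opens_closes p (rev_ord j) (rev_ord i).
Proof.
have tE (w : n.*2.-tuple bool) (k : 'I_n.*2) : tnth w k = nth false w k.
  exact: tnth_nth.
have [i_lt j_lt] := (ltn_ord i, ltn_ord j).
rewrite /opens_closes !tE !nth_conjugate // negbK /=.
have -> : n.*2 - j.+1 < n.*2 - i.+1 = (i < j) by lia.
have revE (k : nat) : n.*2.-1 - k = n.*2 - k.+1 by lia.
rewrite !revE; case: ltnP => //= ij; rewrite andbCA; congr [&& _, _ & _].
rewrite take_rev drop_rev size_drop !size_map size_tuple -map_drop -map_take.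
rewrite balanced_rev_negb (_ : n.*2 - (n.*2 - j) - i.+1 = j - i.+1); last by lia.
rewrite take_drop; congr (balanced (drop _ (take _ p))); lia.
Qed.

Lemma matched_conjugate p (i j : 'I_n.*2) :
  matched (conjugate p) i j = matched p (rev_ord i) (rev_ord j).
Proof. by rewrite /matched !opens_closes_conjugate orbC. Qed.

End Conjugate.

Section Reflection.

Variable n : nat.
Hypothesis n_gt0 : 0 < n.

(** A horizontal edge is named by its left end, which the mirror makes a right end; hence 4n - 3
    rather than 4n - 2. The guards protect against truncated subtraction. *)
Definition refl_config (c : config) : config :=
  Config (fun x y => (x < 4 * n - 2) && hor c (4 * n - 3 - x) y)
         (fun x y => (x <= 4 * n - 2) && ver c (4 * n - 2 - x) y).

Definition refl_pt (p : nat * nat) : nat * nat := (4 * n - 2 - p.1, p.2).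

Lemma refl_edges_in c : edges_in n c -> edges_in n (refl_config c).
Proof.
rewrite /edges_in /has_hor /has_ver /tri => -[ch cv].
by split=> x y /andP[x_le] => [/ch|/cv]; lia.
Qed.

Lemma refl_configK c : edges_in n c ->
  hor (refl_config (refl_config c)) =2 hor c /\
  ver (refl_config (refl_config c)) =2 ver c.
Proof.
rewrite /edges_in /has_hor /has_ver /tri => -[ch cv]; split=> x y /=.
  case: (ltnP x (4 * n - 2)) => x_le /=.
    have -> : 4 * n - 3 - (4 * n - 3 - x) = x by lia.
    by have -> : 4 * n - 3 - x < 4 * n - 2 by lia.
  by apply/esym/negP => /ch; lia.
case: (leqP x (4 * n - 2)) => x_le /=.
  have -> : 4 * n - 2 - (4 * n - 2 - x) = x by lia.
  by have -> : 4 * n - 2 - x <= 4 * n - 2 by lia.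
by apply/esym/negP => /cv; lia.
Qed.

Lemma refl_deg c x y : 0 < x < 4 * n - 2 ->
  deg (refl_config c) x y = deg c (4 * n - 2 - x) y.
Proof.
move=> x_lt; rewrite /deg /=.
have -> : 4 * n - 3 - x = (4 * n - 2 - x).-1 by lia.
have -> : 4 * n - 3 - x.-1 = 4 * n - 2 - x by lia.
have [-> -> ->] : [/\ x < 4 * n - 2, x.-1 < 4 * n - 2 & x <= 4 * n - 2] by split; lia.
have [-> ->] : 0 < x /\ 0 < 4 * n - 2 - x by lia.
by rewrite /=; lia.
Qed.

Lemma refl_conn c p q : edges_in n c -> conn (adj c) p q ->
  conn (adj (refl_config c)) (refl_pt p) (refl_pt q).
Proof.
rewrite /edges_in /has_hor /has_ver /tri => -[ch cv].
apply: conn_map; apply: adjW => [p1 q1|x y h|x y h].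
- exact: (conn_sym (@adj_sym _)).
- apply/(conn_sym (@adj_sym _))/conn1; rewrite /refl_pt /=; have := ch _ _ h => xy.
  rewrite (_ : 4 * n - 2 - x = (4 * n - 2 - x.+1).+1); last by lia.
  apply: adj_hor => /=; have -> : 4 * n - 3 - (4 * n - 2 - x.+1) = x by lia.
  by rewrite h; lia.
- apply/conn1; rewrite /refl_pt /=; have := cv _ _ h => xy.
  apply: adj_ver => /=; have -> : 4 * n - 2 - (4 * n - 2 - x) = x by lia.
  by rewrite h; lia.
Qed.

Lemma eq_conn c c' p q : hor c =2 hor c' -> ver c =2 ver c' ->
  conn (adj c) p q -> conn (adj c') p q.
Proof.
move=> eh ev [s ps lq]; exists s => //.
by rewrite (eq_path (_ : _ =2 adj c)) // => a b; rewrite /adj !eh !ev.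
Qed.

Lemma spec_eq c c' sigma tau pi : hor c =2 hor c' -> ver c =2 ver c' ->
  tfpl_spec (n := n) c sigma tau pi -> tfpl_spec c' sigma tau pi.
Proof.
move=> eh ev.
have ea p q : conn (adj c) p q <-> conn (adj c') p q.
  by split; apply: eq_conn => // x y.
case=> -[f1 f1'] f2 f3 f4h f4v f5h f5v f6 f7 f8; split=> //.
- by split=> x y; rewrite -?eh -?ev; auto.
- by move=> i; rewrite -ev; exact: f2.
- by move=> x y yx xy; rewrite -(f3 _ _ yx xy) /deg !eh !ev.
- by move=> i; rewrite -eh; exact: f4h.
- by move=> i; rewrite -ev; exact: f4v.
- by move=> i; rewrite -eh; exact: f5h.
- by move=> i; rewrite -ev; exact: f5v.
- by move=> i i_lt /(f6 _ i_lt)[j [j1 j2 /ea]]; exists j.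
- by move=> i i_lt /(f7 _ i_lt)[j [j1 j2 /ea]]; exists j.
- by move=> i j /f8 <-; apply: iff_sym.
Qed.

Lemma refl_spec c (sigma tau pi : n.*2.-tuple bool) : tfpl_spec c sigma tau pi ->
  tfpl_spec (refl_config c) (conjugate tau) (conjugate sigma) (conjugate pi).
Proof.
case=> cE f2 f3 f4h f4v f5h f5v f6 f7 f8.
have leftE i : i < n.*2 -> refl_pt (left_vertex i) = right_vertex n (n.*2.-1 - i).
  by move=> i_lt; congr pair; rewrite /=; lia.
have rightE j : j < n.*2 -> refl_pt (right_vertex n j) = left_vertex (n.*2.-1 - j).
  by move=> j_lt; congr pair; rewrite /=; lia.
have csym := conn_sym (@adj_sym (refl_config c)).
split.
- exact: refl_edges_in.
- move=> i i_lt /=; rewrite (_ : 4 * n - 2 - i.*2 = (n.*2.-1 - i).*2); last by lia.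
  by rewrite f2; lia.
- by move=> x y yx xy; rewrite refl_deg; [apply: f3; lia|lia].
- move=> i i_lt /=; have := f5h (n.*2.-1 - i).
  have -> : (n.*2.-1 + (n.*2.-1 - i)).-1 = 4 * n - 3 - i by lia.
  have -> : n.*2.-1 - (n.*2.-1 - i) = i by lia.
  by move=> ->; lia.
- move=> i i_lt; rewrite nth_conjugate ?negbK; last by lia.
  rewrite -f5v /=; last by lia.
  have -> : n.*2.-1 + (n.*2.-1 - i) = 4 * n - 2 - i by lia.
  have -> : n.*2.-1 - (n.*2.-1 - i) = i by lia.
  by case: ver; lia.
- move=> j j_lt /=; have := f4h (n.*2.-1 - j).
  have -> : 4 * n - 3 - (n.*2.-1 + j).-1 = n.*2.-1 - j by lia.
  by move=> ->; lia.
- move=> j j_lt; rewrite nth_conjugate; last by lia.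
  rewrite -f4v /=; last by lia.
  have -> : 4 * n - 2 - (n.*2.-1 + j) = n.*2.-1 - j by lia.
  by case: ver; lia.
- move=> i i_lt; rewrite nth_conjugate // => ti; have [||j [j_lt sj ij]] := f7 (n.*2.-1 - i).
  + by lia.
  + by [].
  exists (n.*2.-1 - j); split; first by lia.
    by rewrite nth_conjugate ?negbK ?subKn //; lia.
  move/(refl_conn cE)/csym: ij; rewrite leftE // rightE; last by lia.
  by rewrite subKn //; lia.
- move=> j j_lt; rewrite nth_conjugate ?negbK // => sj.
  have [||i [i_lt ti ij]] := f6 (n.*2.-1 - j).
  + by lia.
  + by [].
  exists (n.*2.-1 - i); split; first by lia.
    by rewrite nth_conjugate ?subKn //; lia.
  move/(refl_conn cE)/csym: ij; rewrite leftE ?rightE //; last by lia.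
  by rewrite subKn //; lia.
- move=> i j ij; rewrite matched_conjugate -f8 ?(inj_eq rev_ord_inj) //.
  have revE (k : 'I_n.*2) : refl_pt (k.*2, 0) = ((rev_ord k).*2, 0).
    by have := ltn_ord k; rewrite /refl_pt /= => ?; congr pair; lia.
  rewrite -!revE; split=> [/(refl_conn (refl_edges_in cE))|].
    by have [eh ev] := refl_configK cE; apply: eq_conn.
  by move/(refl_conn cE); rewrite !revE !rev_ordK.
Qed.

Definition refl_set (f : {set edge n}) : {set edge n} :=
  edge_set n (refl_config (config_of f)).

Lemma config_of_refl_set (f : {set edge n}) : {in f, forall e, is_edge e} ->
  hor (config_of (refl_set f)) =2 hor (refl_config (config_of f)) /\
  ver (config_of (refl_set f)) =2 ver (refl_config (config_of f)).
Proof.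
move=> /(edges_in_config_of n_gt0)/refl_edges_in[ch cv].
split=> x y; have [Eh Ev] := config_of_edge_set n_gt0 (refl_config (config_of f)) x y.
  rewrite Eh; apply/andP/idP => [[]//|h]; split=> //; exact: ch.
rewrite Ev; apply/andP/idP => [[]//|h]; split=> //; exact: cv.
Qed.

Lemma refl_set_inj (f g : {set edge n}) :
  {in f, forall e, is_edge e} -> {in g, forall e, is_edge e} ->
  refl_set f = refl_set g -> f = g.
Proof.
move=> fE gE fg; have [fh fv] := config_of_refl_set fE.
have [gh gv] := config_of_refl_set gE.
have [fh2 fv2] := refl_configK (edges_in_config_of n_gt0 fE).
have [gh2 gv2] := refl_configK (edges_in_config_of n_gt0 gE).
have Eh : hor (refl_config (config_of f)) =2 hor (refl_config (config_of g)).
  by move=> x y; rewrite -fh -gh fg.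
have Ev : ver (refl_config (config_of f)) =2 ver (refl_config (config_of g)).
  by move=> x y; rewrite -fv -gv fg.
apply: config_of_inj => x y.
  by rewrite -fh2 -gh2; apply: (congr1 (andb _)); apply: Eh.
by rewrite -fv2 -gv2; apply: (congr1 (andb _)); apply: Ev.
Qed.

Lemma refl_tfpl (f : {set edge n}) (sigma tau pi : n.*2.-tuple bool) :
  is_tfpl f sigma tau pi ->
  is_tfpl (refl_set f) (conjugate tau) (conjugate sigma) (conjugate pi).
Proof.
move/(tfplP _ _ _ _ n_gt0)=> [fE fS]; apply/(tfplP _ _ _ _ n_gt0).
split; first exact: edge_set_edges.
have [fh fv] := config_of_refl_set fE.
by apply: spec_eq (refl_spec fS) => x y.
Qed.

End Reflection.

(** * Horizontal strips and counts of ones *)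

Lemma ones_mono w i j : i <= j <= size w ->
  ones w i <= ones w j /\ ones w j + i <= ones w i + j.
Proof.
case/andP=> ij; rewrite -(subnKC ij); elim: (j - i) => [|k IH] sw; first by rewrite addn0; lia.
have [h1 h2] : ones w i <= ones w (i + k) /\ ones w (i + k) + i <= ones w i + (i + k).
  by apply: IH; lia.
by rewrite addnS onesS; lia.
Qed.

Lemma nth_filter_iota (p : pred nat) N m :
  m < count p (iota 0 N) ->
  let z := nth 0 (filter p (iota 0 N)) m in
  [/\ z < N, p z & count p (iota 0 z) = m].
Proof.
elim: N => [|N IH] //; rewrite -(addn1 N) iotaD add0n filter_cat count_cat /= addn0.
rewrite nth_cat size_filter; case: (ltnP m (count p (iota 0 N))) => [m_lt _|m_ge].
  by have [z_lt pz cz] := IH m_lt; split=> //; lia.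
case pN: (p N) => /= m_lt; last by lia.
have -> : m = count p (iota 0 N) by lia.
by rewrite subnn /= pN; split=> //; lia.
Qed.

Lemma count_zeros w z : z <= size w ->
  count (fun i => ~~ nth true w i) (iota 0 z) + ones w z = z.
Proof.
elim: z => [|z IH] z_lt; first by rewrite ones0.
rewrite -[in iota _ _](addn1 z) iotaD count_cat /= addn0 onesS // add0n.
have := IH (ltnW z_lt); rewrite (set_nth_default false) //.
by case: nth; lia.
Qed.

Section Arrow.

Variable n : nat.
Implicit Types s t w : n.*2.-tuple bool.

Lemma dyckP w : w \in dyck n ->
  ones w n.*2 = n /\ forall i, i <= n.*2 -> (ones w i).*2 <= i.
Proof. by rewrite inE => /balancedP[]; rewrite size_tuple; split=> //; lia. Qed.

(* The box in column c of the row of the m-th 0 is present iff the c-th 1     *)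
(* comes before this 0, i.e. iff the prefix of length m + c + 1 has more than *)
(* c ones.                                                                    *)
Lemma mem_diagram w (r c : 'I_n) : w \in dyck n ->
  ((r, c) \in diagram w) = (c < ones w (n - r + c)).
Proof.
move=> /dyckP[w_n _]; have [r_lt c_lt] := (ltn_ord r, ltn_ord c).
have cz : count (fun i => ~~ nth true w i) (iota 0 n.*2) = n.
  by have := @count_zeros w n.*2; rewrite size_tuple leqnn w_n => /(_ isT); lia.
rewrite inE /rows size_tuple /= nth_rev size_map size_filter cz //.
rewrite (nth_map 0); last by rewrite size_filter cz; lia.
have := @nth_filter_iota (fun i => ~~ nth true w i) n.*2 (n - r.+1); rewrite cz.
case; first by lia.
set z := nth 0 _ _ => z_lt wz zm.
have := @count_zeros w z; rewrite size_tuple zm -/(ones w z) => /(_ (ltnW z_lt)) oz.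
have wzF : nth false w z = false.
  by apply/negbTE; rewrite (set_nth_default true) ?size_tuple.
have ozS : ones w z.+1 = ones w z by rewrite onesS ?size_tuple // wzF addn0.
apply/idP/idP => h.
  by have := @ones_mono w (n - r + c) z; rewrite size_tuple; lia.
rewrite ltnNge; apply/negP => oc.
by have := @ones_mono w z.+1 (n - r + c); rewrite size_tuple ozS; lia.
Qed.

(* Each 0 of [s] moves to the right over some of the 1s up to the next 0.     *)
Definition ones_step (s t : seq bool) : Prop :=
  forall i, i <= n.*2 -> ones s i <= ones t i <= (ones s i).+1 /\
    (i < n.*2 -> ones t i = (ones s i).+1 -> nth false s i).

(** By [mem_diagram], a box of column [c] is a prefix length [i], and it is an added box iff
    [ones s i <= c < ones t i]. A strip allows at most one such [i] for each [c]. *)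
Lemma arrowP s t : s \in dyck n -> t \in dyck n -> arrow s t <-> ones_step s t.
Proof.
move=> sD tD; have [[s_n _] [t_n _]] := (dyckP sD, dyckP tD).
have mono w i j : i <= j <= n.*2 -> ones w i <= ones w j /\ ones w j + i <= ones w i + j.
  by have := @ones_mono w i j; rewrite size_tuple.
have ones_n w i : ones w n.*2 = n -> i <= n.*2 -> ones w i <= n /\ i <= ones w i + n.
  by move=> w_n i_le; have := mono w i n.*2; rewrite w_n leqnn i_le => /(_ isT); lia.
have onesi w i : i <= n.*2 -> ones w i <= i.
  by move=> i_le; apply: ones_le; rewrite size_tuple.
have row i c : c < i <= n + c -> exists r : 'I_n, n - r + c = i.
  move=> ci; have r_lt : n + c - i < n by lia.
  by exists (Ordinal r_lt); rewrite /=; lia.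
have mem_diff (r c : 'I_n) : ((r, c) \in diagram t :\: diagram s) =
    (ones s (n - r + c) <= c < ones t (n - r + c)).
  by rewrite inE !mem_diagram // -leqNgt.
split=> [/andP[/subsetP st /forall_inP strip]|st].
  have {}strip (r r' c : 'I_n) :
      (r, c) \in diagram t :\: diagram s -> (r', c) \in diagram t :\: diagram s ->
      r = r'.
    move=> rS r'S; have /forall_inP/(_ _ r'S) := strip _ rS.
    by rewrite eqxx => /eqP[].
  have diff2F (i i' c : nat) : c < n -> i < i' -> c < i -> i' <= n + c ->
      ones s i <= c < ones t i -> ones s i' <= c < ones t i' -> False.
    move=> c_lt ii' ci i'_le hi hi'.
    have [r rE] : exists r : 'I_n, n - r + c = i by apply: row; lia.
    have [r' r'E] : exists r : 'I_n, n - r + c = i' by apply: row; lia.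
    have rr' := strip r r' (Ordinal c_lt); rewrite !mem_diff /= rE r'E in rr'.
    by move: (rr' hi hi') rE r'E => <-; lia.
  move=> i i_le; have [s_le t_le] := (ones_n s i s_n i_le, ones_n t i t_n i_le).
  have [s_i t_i] := (onesi s i i_le, onesi t i i_le).
  have le1 : ones s i <= ones t i.
    case: (posnP (ones s i)) => [->//|s_gt0].
    case: (ltnP (n + ones s i) i.+1) => [|i_lt]; first by lia.
    have c_lt : (ones s i).-1 < n by lia.
    have [r rE] : exists r : 'I_n, n - r + (ones s i).-1 = i by apply: row; lia.
    have := st (r, Ordinal c_lt); rewrite !mem_diagram //= rE; lia.
  (* Otherwise column [ones s i] has added boxes at the prefix lengths [i.-1] and [i]. *)
  have le2 : ones t i <= (ones s i).+1.
    rewrite leqNgt; apply/negP => t_gt.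
    have i_gt0 : 0 < i by case: (i) t_gt => //; rewrite !ones0.
    have := mono s i.-1 i; have := mono t i.-1 i; rewrite leq_pred i_le.
    move=> /(_ isT) m1 /(_ isT) m2.
    by apply: (@diff2F i.-1 i (ones s i)); lia.
  split=> [|i_lt tE]; first by rewrite le1.
  (* If this letter were 0, column [ones s i] would have added boxes at [i] and [i.+1]. *)
  case sE: (nth false s i) => //.
  have sS : ones s i.+1 = ones s i by rewrite onesS ?size_tuple // sE addn0.
  have := mono t i i.+1; rewrite leqnSn i_lt => /(_ isT) m1.
  have := ones_n s i.+1 s_n i_lt => m2.
  by case: (@diff2F i i.+1 (ones s i)); lia.
apply/andP; split.
  apply/subsetP => -[r c]; rewrite !mem_diagram // => h.
  have [r_lt c_lt] := (ltn_ord r, ltn_ord c).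
  by have [] := st (n - r + c) _; lia.
(* At an added box the next letter of [s] is 1, so [s] already has the boxes of this column at all
   greater prefix lengths. *)
have diff2F (r r' c : 'I_n) : r' < r ->
    (r, c) \in diagram t :\: diagram s -> (r', c) \in diagram t :\: diagram s -> False.
  rewrite !mem_diff => r'r h h'; have [r_lt c_lt] := (ltn_ord r, ltn_ord c).
  have [st1 st2] : ones s (n - r + c) <= ones t (n - r + c) <= (ones s (n - r + c)).+1 /\
      nth false s (n - r + c).
    by have [h1 h2] := st (n - r + c) ltac:(lia); split; [|apply: h2; lia].
  have := mono s (n - r + c).+1 (n - r' + c); rewrite onesS ?size_tuple ?st2; lia.
apply/forall_inP => -[r c] rS; apply/forall_inP => -[r' c'] r'S.
apply/implyP => /eqP /= cE; move: r'S; rewrite -{c'}cE => r'S.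
rewrite xpair_eqE eqxx andbT -val_eqE /=; case: ltngtP => // rr'.
  by case: (diff2F r' r c).
by case: (diff2F r r' c).
Qed.

(** Reading backwards turns the condition on the next letter of [s] into one on the preceding
    letter. *)
Lemma arrow_conjugateP s t : s \in dyck n -> t \in dyck n ->
  arrow (conjugate s) (conjugate t) <->
  forall i, i <= n.*2 -> ones s i <= ones t i <= (ones s i).+1 /\
    (0 < i -> ones t i = (ones s i).+1 -> ~~ nth false s i.-1).
Proof.
move=> sD tD; have [[s_n _] [t_n _]] := (dyckP sD, dyckP tD).
have onesE w i : ones w n.*2 = n -> i <= n.*2 ->
    ones (conjugate w) i + n = i + ones w (n.*2 - i).
  move=> w_n i_le; have := @ones_rev_negb w i; rewrite size_tuple w_n => /(_ i_le).
  by [].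
rewrite arrowP ?conjugate_dyck //; split=> st i i_le.
  have [] := st (n.*2 - i) (leq_subr _ _).
  have := onesE s (n.*2 - i) s_n (leq_subr _ _).
  have := onesE t (n.*2 - i) t_n (leq_subr _ _); rewrite subKn // => Et Es h1 h2.
  split=> [|i_gt0 h]; first by lia.
  have i_lt : n.*2 - i < n.*2 by lia.
  have := h2 i_lt; rewrite nth_conjugate // => h3.
  have -> : i.-1 = n.*2.-1 - (n.*2 - i) by lia.
  by apply: h3; lia.
have [] := st (n.*2 - i) (leq_subr _ _).
have := onesE s i s_n i_le; have := onesE t i t_n i_le => Et Es h1 h2.
split=> [|i_lt h]; first by lia.
rewrite nth_conjugate //; have -> : n.*2.-1 - i = (n.*2 - i).-1 by lia.
by apply: h2; lia.
Qed.

Lemma dyck_first w : 0 < n -> w \in dyck n -> nth false w 0 = false.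
Proof.
move=> n_gt0 /dyckP[_ w_le]; have := w_le 1; rewrite onesS ?ones0 ?size_tuple; last by lia.
by case: nth; lia.
Qed.

Lemma dyck_last w : 0 < n -> w \in dyck n -> nth false w n.*2.-1.
Proof.
move=> n_gt0 /dyckP[w_n w_le]; have := w_le n.*2.-1; have := @onesS w n.*2.-1.
by rewrite size_tuple prednK ?w_n; last lia; case: nth; lia.
Qed.

End Arrow.

(** * Boundary words are Dyck words *)

Section SpecTheory.

Variables (n : nat) (c : config) (sigma tau : seq bool) (pi : n.*2.-tuple bool).
Hypothesis n_gt0 : 0 < n.
Hypothesis cS : tfpl_spec c sigma tau pi.

Lemma spec_horF x y : (x < y) || (4 * n - 2 <= x + y) -> hor c x y = false.
Proof.
move=> xy; have [ch _] := spec_edges cS; apply/negbTE/negP => /ch.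
by rewrite /has_hor /tri; lia.
Qed.

Lemma spec_verF x y : [|| x < y, 4 * n - 2 < x + y | (y == 0) && odd x] ->
  ver c x y = false.
Proof.
move=> xy; have [_ cv] := spec_edges cS; apply/negbTE/negP => /cv.
by rewrite /has_ver /tri; lia.
Qed.

Lemma spec_deg_left i : deg c i i = hor c i i + ver c i i.
Proof.
rewrite /deg (@spec_verF i i.+1) ?leqnn // addn0.
by case: i => [|i] /=; rewrite ?(@spec_horF i i.+1) ?leqnn //= !addn0.
Qed.

Lemma spec_deg_right x y : x + y = 4 * n - 2 -> y <= x ->
  deg c x y = hor c x.-1 y + ver c x y.
Proof.
move=> xy yx; rewrite /deg (@spec_horF x y) ?(@spec_verF x y.+1); [|lia|lia].
by rewrite add0n addn0; have -> : 0 < x by lia.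
Qed.

Lemma spec_degF x y : (x < y) || (4 * n - 2 < x + y) -> deg c x y = 0.
Proof.
move=> xy.
rewrite /deg spec_horF ?(@spec_horF x.-1 y) ?spec_verF ?(@spec_verF x y.+1) ?andbF;
  lia.
Qed.

Lemma spec_deg2 x y : deg c x y <= 2.
Proof.
case: (boolP ((x < y) || (4 * n - 2 < x + y))) => [/spec_degF -> //|xy].
have [->|xy'] := eqVneq x y; first by rewrite spec_deg_left; lia.
have [xyE|xy''] := eqVneq (x + y) (4 * n - 2).
  by rewrite spec_deg_right; lia.
by rewrite (spec_degree cS); lia.
Qed.

Lemma left_pendant i : i < n.*2 -> (0 < i -> nth false sigma i) ->
  pendant (adj c) (left_vertex i).
Proof.
move=> i_lt si; apply: deg_pendant; rewrite spec_deg_left.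
case: (posnP i) si => [->|i_gt0 /(_ isT) si]; first by lia.
by rewrite (spec_left_ver cS) ?i_gt0 // si; lia.
Qed.

Lemma right_pendant j : j < n.*2 -> (j < n.*2.-1 -> ~~ nth false tau j) ->
  pendant (adj c) (right_vertex n j).
Proof.
move=> j_lt tj; apply: deg_pendant; rewrite spec_deg_right; [|lia|lia].
case: (ltnP j n.*2.-1) tj => [j_lt' /(_ isT) tj|j_ge _].
  by rewrite (spec_right_ver cS) // (negbTE tj); lia.
have -> : n.*2.-1 - j = 0 by lia.
by rewrite eqxx /=; lia.
Qed.

Lemma spec_three p q r : pendant (adj c) p -> pendant (adj c) q -> pendant (adj c) r ->
  conn (adj c) p q -> conn (adj c) p r -> [\/ p = q, p = r | q = r].
Proof. by apply: three_pendants; [exact: adj_sym|exact: (deg_adj2 spec_deg2)]. Qed.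

Lemma left_ver_spec i : nth false sigma 0 = false -> i < n.*2 ->
  ver c i i = ~~ nth false sigma i.
Proof.
move=> s0; case: i => [_|i i_lt]; last exact: (spec_left_ver cS).
by rewrite s0 (spec_external cS (i := 0)); lia.
Qed.

Lemma right_ver_spec j : nth false tau n.*2.-1 -> j < n.*2 ->
  ver c (n.*2.-1 + j) (n.*2.-1 - j) = nth false tau j.
Proof.
move=> t_last j_lt; case: (ltnP j n.*2.-1) => [|j_ge]; first exact: (spec_right_ver cS).
have -> : j = n.*2.-1 by lia.
rewrite t_last subnn addnn; apply: (spec_external cS); lia.
Qed.

(** An edge from antidiagonal [m] to the next one, named by its end on the former and its
    direction. *)
Definition crossing (m x : nat) (b : bool) : bool :=
  if b then hor c x (m - x) else ver c x (m - x).+1.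

Definition crossings (m : nat) : nat :=
  \sum_(x < m.+1) (hor c x (m - x) + ver c x (m - x).+1).

(** Every edge at a vertex of antidiagonal [m.+1] goes to one of the two neighbouring antidiagonals,
    except an external edge. *)
Lemma sum_degS m : \sum_(x < m.+2) deg c x (m.+1 - x) =
  crossings m.+1 + crossings m + ver c m.+1 0.
Proof.
have -> : \sum_(x < m.+2) deg c x (m.+1 - x) = crossings m.+1 +
    (\sum_(x < m.+2) ((0 < x) && hor c x.-1 (m.+1 - x) : nat) +
     \sum_(x < m.+2) ver c x (m.+1 - x)).
  by rewrite /crossings -!big_split; apply: eq_bigr => x _; rewrite /deg /=; lia.
rewrite -addnA; congr (_ + _).
rewrite big_ord_recl add0n [\sum_(x < m.+2) _]big_ord_recr /= subnn addnA.
congr (_ + _); rewrite /crossings -big_split; apply: eq_bigr => x _ /=.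
by rewrite /bump /= add1n subSS subSn // -ltnS.
Qed.

Lemma sum_deg_odd p : p < n.*2.-1 -> \sum_(x < p.*2.+2) deg c x (p.*2.+1 - x) = p.+1.*2.
Proof.
move=> p_lt; rewrite -(big_mkord xpredT (fun x => deg c x (p.*2.+1 - x))).
rewrite (big_cat_nat (n := p.+1)) //=; last by lia.
rewrite big_nat big1 => [|x x_lt]; last by rewrite spec_degF; lia.
rewrite big_nat (eq_bigr (fun=> 2)) => [|x x_lt]; last by rewrite (spec_degree cS); lia.
by rewrite -big_nat sum_nat_const_nat; lia.
Qed.

Lemma sum_deg_even p : p < n.*2.-1 -> \sum_(x < p.*2.+1) deg c x (p.*2 - x) =
  p.*2 + 1 + ver c p p.
Proof.
move=> p_lt; rewrite -(big_mkord xpredT (fun x => deg c x (p.*2 - x))).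
rewrite (big_cat_nat (n := p)) //=; last by lia.
rewrite big_nat big1 => [|x x_lt]; last by rewrite spec_degF; lia.
rewrite big_ltn; last by lia.
have -> : p.*2 - p = p by lia.
rewrite spec_deg_left (spec_left_hor cS) //.
rewrite big_nat (eq_bigr (fun=> 2)) => [|x x_lt]; last by rewrite (spec_degree cS); lia.
by rewrite -big_nat sum_nat_const_nat; lia.
Qed.

Hypothesis sigma_size : size sigma = n.*2.
Hypothesis sigma0 : nth false sigma 0 = false.

(** Inside, all degrees are 2, so from [p] to [p.+1] the count changes only through the external
    edge and the left boundary vertex: it grows by one exactly when the new letter is 0. *)
Lemma crossings_even p : p < n.*2.-1 -> crossings p.*2 + ones sigma p.+1 = p.+1.
Proof.
elim: p => [|p IH] p_lt.
  rewrite /crossings big_ord1 subn0 (spec_left_hor cS) // spec_verF //.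
  by rewrite onesS ?ones0 ?sigma0 // sigma_size; lia.
have := sum_degS p.*2; rewrite (sum_deg_odd (ltnW p_lt)) (@spec_verF p.*2.+1 0); last by lia.
have := sum_degS p.*2.+1; rewrite -doubleS (sum_deg_even p_lt).
rewrite (spec_external cS) ?(spec_left_ver cS); [|lia|lia].
by have := IH (ltnW p_lt); rewrite (@onesS _ p.+1) ?sigma_size; lia.
Qed.

Lemma conn_crossing m p q : conn (adj c) p q -> p.1 + p.2 <= m < q.1 + q.2 ->
  exists x b, [/\ x <= m, crossing m x b & conn (adj c) p (x, m - x)].
Proof.
case=> s; elim: s p => [|r s IH] p /=; first by move=> _ -> /andP[+ q_gt]; rewrite leqNgt q_gt.
case/andP=> pr rs lq pq; have [r_le|r_gt] := leqP (r.1 + r.2) m.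
  have [|x [b [x_le xb rx]]] := IH _ rs lq; first by rewrite r_le; case/andP: pq.
  by exists x, b; split=> //; apply: conn_trans rx; apply: conn1.
exists p.1; move: pr r_gt pq; case: p r {rs lq} => [x y] [x' y']; rewrite /adj /=.
rewrite /crossing => h r_gt pq; have -> : m - x = y.
  by move: h; rewrite !xpair_eqE; lia.
case/or4P: h => /andP[/eqP[? ?] h]; subst; try lia.
  by exists true; split=> //; [lia|exact: conn_refl].
by exists false; split=> //; [lia|exact: conn_refl].
Qed.

(** Each path starting at one of these 1s ends on the right boundary, beyond the antidiagonal, so it
    crosses. Two of them sharing a crossing would give a component with three pendant vertices. *)
Lemma ones_crossings k : 0 < k < n.*2 -> ones sigma k <= crossings k.-1.*2.
Proof.
move=> k_lt; set m := k.-1.*2.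
have /fin_all_exists[u uP] (i : 'I_k) : exists u : 'I_m.+1 * bool,
    nth false sigma i ->
    crossing m u.1 u.2 /\ conn (adj c) (left_vertex i) (nat_of_ord u.1, m - u.1).
  case si: (nth false sigma i); last by exists (ord0, true).
  have i_lt : i < n.*2 by have := ltn_ord i; lia.
  have [j [j_lt tj ij]] := spec_left_path cS i_lt si.
  have [|x [b [x_le xb ix]]] := @conn_crossing m _ _ ij.
    by have := ltn_ord i; rewrite /m /=; lia.
  by exists (Ordinal (x_le : x < m.+1), b).
have -> : ones sigma k = #|[set i : 'I_k | nth false sigma i]|.
  rewrite -sum1dep_card; have : k <= size sigma by rewrite sigma_size; lia.
  elim: (k) => [|l IH] l_lt; first by rewrite ones0 big_ord0.
  rewrite onesS // IH ?(ltnW l_lt) // [RHS]big_mkcond big_ord_recr -big_mkcond /=.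
  by case: nth.
have -> : crossings m = #|[set v : 'I_m.+1 * bool | crossing m v.1 v.2]|.
  rewrite -sum1dep_card big_mkcond.
  rewrite (eq_bigr (fun v : 'I_m.+1 * bool => nat_of_bool (crossing m v.1 v.2)));
    last by move=> v _; case: crossing.
  rewrite -(pair_big xpredT xpredT
              (fun x b => nat_of_bool (crossing m (nat_of_ord x) b))) /=.
  by apply: eq_bigr => x _; rewrite big_bool.
rewrite -(card_in_imset (f := u)).
  apply/subset_leq_card/subsetP => v /imsetP[i]; rewrite !inE => si ->.
  by have [] := uP i si.
move=> i i'; rewrite !inE => si si' uE; apply/val_inj => /=.
have [[_ ix] [_ ix']] := (uP i si, uP i' si'); rewrite -uE in ix'.
have [i_lt i'_lt] : i < n.*2 /\ i' < n.*2 by have := ltn_ord i; have := ltn_ord i'; lia.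
have ii' : conn (adj c) (left_vertex i) (left_vertex i').
  by apply: conn_trans ix _; apply: (conn_sym (@adj_sym c)).
have [j [j_lt tj ij]] := spec_left_path cS i_lt si.
have [] := spec_three _ _ _ ii' ij; try by [exact: left_pendant|exact: right_pendant].
- by case.
- by case; have := ltn_ord i; lia.
- by case; have := ltn_ord i'; lia.
Qed.

(* The paths starting on the left below the k-th left vertex have to cross    *)
(* the antidiagonal there, through as many edges as sigma has zeros.          *)
Lemma spec_balanced : ones sigma n.*2 = n -> balanced sigma.
Proof.
move=> sigma_n; apply/balancedP; rewrite sigma_size sigma_n; split=> // k k_le.
case: (posnP k) => [->|k_gt0]; first by rewrite ones0.
have [->|k_ne] := eqVneq k n.*2; first by rewrite sigma_n; lia.
have := @ones_crossings k; have := @crossings_even k.-1; rewrite prednK //.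
lia.
Qed.

End SpecTheory.

(** * The drift *)

Local Notation "w .[ i ]" := (nth false w i).

(* Comparing [s] and [t] letter by letter, [rho] tells whether a 1 of [t] is  *)
(* still ahead of its counterpart in [s].                                     *)
Definition rho (s t : seq bool) (i : nat) : bool := ones t i != ones s i.

(* [c] with one edge added at each new left boundary vertex [(i.+1, i.+1)]    *)
(* with [s.[i]] = 1, joining it to an old one with letter 1 in [t]: the       *)
(* horizontal edge to the i-th, or the vertical edge to the preceding one.    *)
Definition ext_config (s t : seq bool) (c : config) : config :=
  Config
    (fun x y => (0 < y) && if x == y then s.[y.-1] && ~~ rho s t y.-1
                           else (1 < x) && hor c x.-2 y.-1)
    (fun x y => (0 < y) && if x == y then s.[y.-1] && rho s t y.-1
                           else (1 < x) && ver c x.-2 y.-1).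

Lemma hor_ext s t c x y : y <= x -> hor (ext_config s t c) x.+2 y.+1 = hor c x y.
Proof. by move=> yx; rewrite /= eqSS; case: eqP => //; lia. Qed.

Lemma ver_ext s t c x y : y <= x -> ver (ext_config s t c) x.+2 y.+1 = ver c x y.
Proof. by move=> yx; rewrite /= eqSS; case: eqP => //; lia. Qed.

Section Drift.

Variables (n : nat) (sigma sigma1 tau pi : n.*2.-tuple bool) (c : config).
Hypothesis n_gt0 : 0 < n.
Hypotheses (sigma_dyck : sigma \in dyck n) (sigma1_dyck : sigma1 \in dyck n).
Hypothesis tau_dyck : tau \in dyck n.
Hypothesis step : ones_step n sigma sigma1.
Hypothesis cS : tfpl_spec c sigma1 tau pi.

Let F := ext_config sigma sigma1 c.
Let G := gyr n F.
Let r := rho sigma sigma1.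

Lemma rhoE i : i <= n.*2 -> ones sigma1 i = ones sigma i + r i.
Proof. by move=> /step[+ _]; rewrite /r /rho; lia. Qed.

Lemma rho_sigma i : i < n.*2 -> r i -> sigma.[i].
Proof.
move=> i_lt ri; have [_ h] := step (ltnW i_lt); apply: h => //.
by rewrite rhoE ?ri ?addn1 // ltnW.
Qed.

Lemma rhoS i : i < n.*2 -> r i.+1 + sigma.[i] = r i + sigma1.[i].
Proof.
move=> i_lt; have := rhoE i_lt; rewrite !onesS ?size_tuple // rhoE ?(ltnW i_lt) //.
lia.
Qed.

Lemma rho0 : r 0 = false.
Proof. by rewrite /r /rho !ones0. Qed.

Lemma rho_last : r n.*2 = false.
Proof.
have [[s_n _] [s1_n _]] := (dyckP sigma_dyck, dyckP sigma1_dyck).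
by rewrite /r /rho s_n s1_n eqxx.
Qed.

Lemma hor_diag i : hor F i.+1 i.+1 = sigma.[i] && ~~ r i.
Proof. by rewrite /= eqxx. Qed.

Lemma ver_diag i : ver F i.+1 i.+1 = sigma.[i] && r i.
Proof. by rewrite /= eqxx. Qed.

Lemma nth_lt (w : n.*2.-tuple bool) i : w.[i] -> i < n.*2.
Proof. by rewrite -{2}(size_tuple w); case: ltnP => // /(nth_default false) ->. Qed.

Lemma ext_supported : supported n F.
Proof.
have [ch cv] := spec_edges cS.
split=> x [//|y]; rewrite [X in is_true X -> _]/=; have [->|xy] := eqVneq x y.+1.
- by case/andP=> /nth_lt y_lt _; rewrite /regh /reg; case: ifP; lia.
- case/andP=> x_gt /ch; rewrite /has_hor /tri /regh /reg; case: ifP; lia.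
- by case/andP=> /nth_lt y_lt _; rewrite /regv /reg; case: ifP; lia.
- case/andP=> x_gt /cv; rewrite /has_ver /tri /regv /reg; case: ifP; lia.
Qed.

Let left_ver i (i_lt : i < n.*2) : ver c i i = ~~ sigma1.[i].
Proof. exact: (left_ver_spec n_gt0 cS (dyck_first n_gt0 sigma1_dyck)). Qed.

Let right_ver j (j_lt : j < n.*2) : ver c (n.*2.-1 + j) (n.*2.-1 - j) = tau.[j].
Proof. exact: (right_ver_spec n_gt0 cS (dyck_last n_gt0 tau_dyck)). Qed.

(** The point is the old left boundary: by [rhoS], the added edges at its i-th vertex number exactly
    [sigma1.[i]], which makes up for the missing vertical edge. *)
Lemma ext_deg x y : inner n x y -> deg F x y = 2.
Proof.
case/and3P; case: y => // y _; case: x => [//|[//|x]]; rewrite !ltnS => yx xy.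
move: yx; rewrite leq_eqVlt => /orP[/eqP yx|yx].
  rewrite -{x}yx in xy *; rewrite /deg hor_ext // ver_ext // hor_diag ver_diag.
  rewrite (spec_left_hor cS); last by lia.
  rewrite left_ver; last by lia.
  have y_lt : y < n.*2 by lia.
  have yS_lt : y.+1 < n.*2 by lia.
  have /implyP := @rho_sigma y y_lt; have /implyP := @rho_sigma y.+1 yS_lt.
  by have := rhoS y_lt; case: (r y); case: (r y.+1); lia.
rewrite -(spec_degree cS yx); last by lia.
have -> : deg c x y = hor c x y + hor c x.-1 y + ver c x y + ver c x y.+1.
  by rewrite /deg; have -> : 0 < x by lia.
rewrite /deg hor_ext; last by lia.
rewrite ver_ext; last by lia.
rewrite ver_ext //; case: (x) yx => // x' yx; rewrite hor_ext //; lia.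
Qed.

Lemma ext_deg2 x y : deg F x y <= 2.
Proof.
case: (boolP (inner n x y)) => [/ext_deg -> //|]; exact: (supported_deg ext_supported).
Qed.

Lemma drift_supported : supported n G.
Proof. exact: gyr_supported. Qed.

Lemma drift_deg x y : inner n x y -> deg G x y = 2.
Proof. by move=> xy; have := gyr_deg F xy; rewrite ext_deg //; rewrite -/G; lia. Qed.

Lemma drift_deg2 x y : deg G x y <= 2.
Proof.
case: (boolP (inner n x y)) => [/drift_deg -> //|]; exact: (supported_deg drift_supported).
Qed.

(** The cell used has the new boundary vertex as its upper left corner. Its right side is the
    vertical edge below the i-th old left vertex and, for [i > 0], its bottom side is the horizontal
    edge from the preceding one. *)
Lemma drift_left i : i < n.*2 ->
  hor G i.+1 i.+1 = true /\ ver G i.+1 i.+1 = ~~ sigma.[i].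
Proof.
move=> i_lt; have ri : reg n i.+1 i by rewrite /reg; lia.
have [_ -> -> _] := gyr_cell F ri.
rewrite /parallel hor_diag ver_diag ver_ext // left_ver //.
case: i i_lt {ri} => [i_lt|i i_lt].
  by rewrite (dyck_first n_gt0 sigma_dyck) (dyck_first n_gt0 sigma1_dyck).
rewrite hor_ext // (spec_left_hor cS); last by lia.
have := rhoS i_lt; have := @rho_sigma i.+1 i_lt; move: (r i.+1) (r i.+2).
by case: sigma.[_]; case: sigma1.[_] => -[] [] //= h; have := h isT.
Qed.

(** The i-th external edge of [c] is the right side of a bottom cell whose left and bottom sides are
    absent. Gyration exchanges it for these two: the left side is the new external edge, and the
    bottom side links it to the foot of the old one. *)
Lemma drift_bottom i : i < n.*2 ->
  [/\ ver G i.*2.+1 1, hor G i.*2.+1 0 & ver G i.*2.+2 1 = false].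
Proof.
move=> i_lt; have ri : reg n i.*2.+1 0 by rewrite /reg; lia.
have E : ver F i.*2.+1 1 = false.
  case: i {i_lt ri} => [|i]; first by rewrite ver_diag (dyck_first n_gt0 sigma_dyck).
  by rewrite doubleS ver_ext // (spec_verF n_gt0 cS); lia.
have P : parallel F i.*2.+1 0 = false.
  by rewrite /parallel E ver_ext // (spec_external cS) //= andbF.
have [-> _ -> ->] := gyr_cell F ri; rewrite P E ver_ext // (spec_external cS) //.
Qed.

(* The edges of the last active cell on an antidiagonal, whose upper right    *)
(* corner is the j-th right boundary vertex of [c].                           *)
Definition ext_left_edge j := ver F (n.*2 + j) (n.*2 - j).
Definition ext_bottom_edge j := hor F (n.*2 + j) (n.*2.-1 - j).
Local Notation s := ext_left_edge.
Local Notation b := ext_bottom_edge.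

Lemma ext_top_edge j : j < n.*2 -> hor F (n.*2 + j) (n.*2 - j).
Proof.
case: (posnP j) => [-> _|j_gt0 j_lt].
  (* Here the edge is the one added at the last left boundary vertex; both words end in 1 and [rho]
     vanishes at the end, so it is horizontal. *)
  have n2 : n.*2.-1.+1 = n.*2 by lia.
  have l_lt : n.*2.-1 < n.*2 by lia.
  rewrite subn0 addn0 -{1 2}n2 hor_diag (dyck_last n_gt0 sigma_dyck) /=.
  have := rhoS l_lt; rewrite n2 rho_last.
  by rewrite (dyck_last n_gt0 sigma_dyck) (dyck_last n_gt0 sigma1_dyck); case: (r _).
have := @spec_right_hor _ _ _ _ _ cS j; rewrite j_gt0 j_lt => /(_ isT).
rewrite -(hor_ext sigma sigma1 c); last by lia.
have -> : (n.*2.-1 + j).-1.+2 = n.*2 + j by lia.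
by have -> : (n.*2.-1 - j).+1 = n.*2 - j by lia.
Qed.

Lemma ext_right_edge j : j < n.*2 -> ver F (n.*2 + j).+1 (n.*2 - j) = tau.[j].
Proof.
move=> j_lt; rewrite -right_ver // -(ver_ext sigma sigma1 c); last by lia.
have -> : (n.*2.-1 + j).+2 = (n.*2 + j).+1 by lia.
by have -> : (n.*2.-1 - j).+1 = n.*2 - j by lia.
Qed.

Lemma left_edge0 : s 0 = false.
Proof.
have n2 : n.*2.-1.+1 = n.*2 by lia.
have l_lt : n.*2.-1 < n.*2 by lia.
rewrite /s subn0 addn0 -{1 2}n2 ver_diag (dyck_last n_gt0 sigma_dyck) /=.
have := rhoS l_lt; rewrite n2 rho_last.
by rewrite (dyck_last n_gt0 sigma_dyck) (dyck_last n_gt0 sigma1_dyck); case: (r _).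
Qed.

Lemma left_edge_last : s n.*2 = false.
Proof. by rewrite /s subnn. Qed.

(** A degree count at the lower right corner of the j-th cell, where the top side of the next cell
    is always present. *)
Lemma bottom_left_edges j : j < n.*2 -> b j + s j.+1 + tau.[j] = 1.
Proof.
move=> j_lt; have [j_eq|j_ne] := eqVneq j n.*2.-1.
  have jS : j.+1 = n.*2 by lia.
  rewrite jS left_edge_last j_eq (dyck_last n_gt0 tau_dyck).
  by rewrite /b subnn.
have xy : inner n (n.*2 + j).+1 (n.*2.-1 - j) by rewrite /inner; lia.
have := ext_deg xy; rewrite /deg /= -/(b j).
have jS : (n.*2.-1 - j).+1 = n.*2 - j by lia.
have := @ext_top_edge j.+1; rewrite addnS.
have -> : n.*2 - j.+1 = n.*2.-1 - j by lia.
have -> : j.+1 < n.*2 by lia.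
move=> /(_ isT); rewrite /= => ->; have := ext_right_edge j_lt; rewrite -jS /= => ->.
rewrite /s addnS; have -> : n.*2 - j.+1 = n.*2.-1 - j by lia.
by rewrite /b /=; lia.
Qed.

(* A path turning back from the j-th right boundary vertex to the next one    *)
(* would end on the right boundary or at the last external edge, not on the   *)
(* left.                                                                      *)
Lemma no_right_turn j : j < n.*2 -> ~~ tau.[j] -> b j -> s j -> False.
Proof.
move=> j_lt tj bj sj; have j_gt0 : 0 < j by case: (posnP j) sj => // ->; rewrite left_edge0.
have j_lt' : j < n.*2.-1.
  rewrite ltn_neqAle; apply/andP; split; last by lia.
  by apply: contraNneq tj => ->; exact: (dyck_last n_gt0 tau_dyck).
have R k : 0 < k < n.*2 -> conn (adj c) (n.*2.-1 + k.-1, n.*2.-1 - k) (right_vertex n k).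
  move=> k_lt; apply: conn1; rewrite /right_vertex.
  have -> : n.*2.-1 + k = (n.*2.-1 + k.-1).+1 by lia.
  apply: adj_hor; have := spec_right_hor cS k_lt.
  by have -> : (n.*2.-1 + k).-1 = n.*2.-1 + k.-1 by lia.
have S := @conn_sym _ _ (@adj_sym c).
(* Descend along the right boundary: a letter 1 gives the vertical edge to the left neighbour of the
   next right vertex. The descent stops at a letter 0 or at the last external edge. *)
have run m k : n.*2 - k < m -> j < k < n.*2 -> exists k', [/\ j < k', k' < n.*2,
    conn (adj c) (right_vertex n k) (right_vertex n k')
    & pendant (adj c) (right_vertex n k')].
  elim: m k => // m IH k m_le k_lt; have [kE|kNE] := eqVneq k n.*2.-1.
    exists k; split; [lia|lia|exact: conn_refl|].
    by apply: (right_pendant n_gt0 cS) => //; lia.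
  case tk: tau.[k]; last first.
    exists k; split; [lia|lia|exact: conn_refl|].
    by apply: (right_pendant n_gt0 cS); rewrite ?tk //; lia.
  have [||k' [k'1 k'2 k'3 k'4]] := IH k.+1; [lia|lia|].
  exists k'; split=> //; apply: conn_trans k'3.
  have kS : 0 < k.+1 < n.*2 by lia.
  apply: conn_trans (R _ kS); apply/S/conn1; rewrite /right_vertex.
  have E : n.*2.-1 - k = (n.*2.-1 - k.+1).+1 by lia.
  rewrite E; apply: adj_ver; rewrite -E right_ver //; lia.
have jS_lt : j < j.+1 < n.*2 by lia.
have [k [k_gt k_lt jk k_end]] := run _ _ (ltnSn _) jS_lt.
(* Along the top, left and bottom sides of the cell, then on to the next right vertex. *)
have jj : conn (adj c) (right_vertex n j) (right_vertex n j.+1).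
  have jS : 0 < j.+1 < n.*2 by lia.
  apply: conn_trans (R _ jS) => /=; have jlt : 0 < j < n.*2 by lia.
  apply: conn_trans (S _ _ (R _ jlt)) _.
  apply: (conn_trans (q := (n.*2.-1 + j.-1, n.*2.-1 - j.+1))).
    apply/S/conn1; have E : n.*2.-1 - j = (n.*2.-1 - j.+1).+1 by lia.
    rewrite E; apply: adj_ver; rewrite -(ver_ext sigma sigma1 c); last by lia.
    have -> : (n.*2.-1 + j.-1).+2 = n.*2 + j by lia.
    by have -> : (n.*2.-1 - j.+1).+2 = n.*2 - j by lia.
  have E : n.*2.-1 + j = (n.*2.-1 + j.-1).+1 by lia.
  apply: conn1; rewrite E; apply: adj_hor; rewrite -(hor_ext sigma sigma1 c); last by lia.
  have -> : (n.*2.-1 + j.-1).+2 = n.*2 + j by lia.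
  by have -> : (n.*2.-1 - j.+1).+1 = n.*2.-1 - j by lia.
have [i [i_lt si ij]] := spec_right_path cS j_lt tj.
have [] := spec_three n_gt0 cS _ _ _ (S _ _ ij) (conn_trans jj jk).
- exact: (right_pendant n_gt0 cS).
- exact: (left_pendant n_gt0 cS).
- exact: k_end.
- by case; lia.
- by case; lia.
- by case; lia.
Qed.

Definition drift_right : n.*2.-tuple bool :=
  [tuple ver G (n.*2 + j) (n.*2 - j) | j < n.*2].
Local Notation tau1 := drift_right.

Lemma nth_drift_right j : j < n.*2 -> tau1.[j] = ver G (n.*2 + j) (n.*2 - j).
Proof.
by move=> j_lt; rewrite -[j]/(nat_of_ord (Ordinal j_lt)) -tnth_nth tnth_mktuple.
Qed.

Lemma drift_right_cell j : j < n.*2 ->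
  [/\ hor G (n.*2 + j) (n.*2.-1 - j),
      hor G (n.*2 + j) (n.*2 - j) = ~~ tau.[j] && ~~ s j.+1,
      ver G (n.*2 + j).+1 (n.*2 - j) = s j.+1,
      tau1.[j] + s j = s j.+1 + tau.[j]
    & s j -> tau1.[j] = false].
Proof.
move=> j_lt; have rj : reg n (n.*2 + j) (n.*2.-1 - j) by rewrite /reg; lia.
rewrite nth_drift_right //.
have jS : (n.*2.-1 - j).+1 = n.*2 - j by lia.
have := gyr_cell F rj; rewrite jS -/G => -[-> -> -> ->]; rewrite /parallel jS.
rewrite ext_top_edge // ext_right_edge // -/(s j) -/(b j).
have := bottom_left_edges j_lt; have := @no_right_turn j j_lt.
case: (b j); case: (s j); case: (s j.+1); case: tau.[j] => //= h _; split=> //.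
all: by case: h.
Qed.

(** The letterwise relation of [drift_right_cell] telescopes; [s] does on the right what [rho] does
    on the left. *)
Lemma ones_drift_right j : j <= n.*2 -> ones tau1 j = ones tau j + s j.
Proof.
elim: j => [|j IH] j_lt; first by rewrite !ones0 left_edge0.
rewrite !onesS ?size_tuple // IH ?(ltnW j_lt) //.
by have [_ _ _ + _] := drift_right_cell j_lt; lia.
Qed.

Lemma ones_drift_right_last : ones tau1 n.*2 = n.
Proof.
by have [t_n _] := dyckP tau_dyck; rewrite ones_drift_right // t_n left_edge_last addn0.
Qed.

Lemma drift_right_last : tau1.[n.*2.-1].
Proof.
have j_lt : n.*2.-1 < n.*2 by lia.
have [_ _ _ + _] := drift_right_cell j_lt; rewrite (dyck_last n_gt0 tau_dyck) prednK; last by lia.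
rewrite left_edge_last /s; have -> : n.*2 - n.*2.-1 = 1 by lia.
have -> : ver F (n.*2 + n.*2.-1) 1 = false; last by lia.
have -> : n.*2 + n.*2.-1 = (4 * n - 3).+2 by lia.
by rewrite ver_ext // (spec_verF n_gt0 cS); lia.
Qed.

(** * The drift and its connections *)

Definition drift_config : config :=
  Config (fun x y => has_hor n x y && hor G x.+1 y.+1)
         (fun x y => has_ver n x y && ver G x.+1 y.+1).
Local Notation d := drift_config.

Lemma conn_ext p q : conn (adj c) p q ->
  conn (adj F) (p.1.+2, p.2.+1) (q.1.+2, q.2.+1).
Proof.
have [ch cv] := spec_edges cS.
apply: (conn_map (f := fun p => (p.1.+2, p.2.+1))).
apply: adjW => /= [p1 q1|x y h|x y h].
- exact: (conn_sym (@adj_sym _)).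
- by apply/conn1/adj_hor; rewrite hor_ext //; have := ch _ _ h; rewrite /has_hor /tri; lia.
- by apply/conn1/adj_ver; rewrite ver_ext //; have := cv _ _ h; rewrite /has_ver /tri; lia.
Qed.

Lemma conn_drift_pt p q : conn (adj d) p q ->
  conn (adj G) (p.1.+1, p.2.+1) (q.1.+1, q.2.+1).
Proof.
apply: (conn_map (f := fun p => (p.1.+1, p.2.+1))).
apply: adjW => /= [p1 q1|x y h|x y h].
- exact: (conn_sym (@adj_sym _)).
- by apply/conn1/adj_hor; case/andP: h.
- by apply/conn1/adj_ver; case/andP: h.
Qed.

Lemma avoiding_sym (S : pred (nat * nat)) (e : rel (nat * nat)) :
  symmetric e -> symmetric (avoiding e S).
Proof. by move=> e_sym x y; rewrite /avoiding /= e_sym andbCA. Qed.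

(** What was added to the old triangle, the new diagonal and the bottom row, consists of pendant
    vertices that can be deleted. *)
Lemma ext_conn x y x' y' : y <= x -> y' <= x' ->
  conn (adj F) (x.+2, y.+1) (x'.+2, y'.+1) -> conn (adj c) (x, y) (x', y').
Proof.
move=> yx yx'; pose S := [pred p : nat * nat | (p.1 == p.2) || (p.2 == 0)].
have [sh sv] := ext_supported.
have Sp p : p \in S -> pendant (adj F) p.
  case: p => [a e]; rewrite inE /= => /orP[/eqP <-|/eqP ->]; apply: deg_pendant.
    case: a => [|a]; first by rewrite /deg /=; lia.
    rewrite /deg hor_diag ver_diag succnK.
    have -> : hor F a a.+1 = false.
      by apply/negP => /sh; rewrite /regh /reg; case: ifP; lia.
    have -> : ver F a.+1 a.+2 = false.
      by apply/negP => /sv; rewrite /regv /reg; case: ifP; lia.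
    by case: (r a); rewrite ?andbF /=; lia.
  by rewrite /deg /=; lia.
have S_out a e : e <= a -> (a.+2, e.+1) \notin S by move=> ?; rewrite inE /=; lia.
move/(conn_avoiding (@adj_sym F) Sp (S_out _ _ yx) (S_out _ _ yx')).
have sub : forall p q, avoiding (adj F) S p q ->
    conn (adj c) (p.1.-2, p.2.-1) (q.1.-2, q.2.-1).
  move=> p q /and3P[+ + pq]; move: p q pq; apply: adjW => [p q IH qS pS|x0 y0|x0 y0].
  - exact: (conn_sym (@adj_sym _) (IH pS qS)).
  - rewrite !inE /= => h; rewrite !negb_or => /andP[xy y_gt] _; move: h.
    rewrite (negbTE xy) => /and3P[_ x_gt h].
    have -> : x0.-1 = x0.-2.+1 by lia.
    exact/conn1/adj_hor.
  - rewrite !inE /= => h; rewrite !negb_or => /andP[_ y_gt] /andP[xy _]; move: h.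
    rewrite (negbTE xy) => /andP[x_gt h]; apply/conn1.
    by rewrite -{2}(prednK (_ : 0 < y0)) ?lt0n //; apply: adj_ver; rewrite prednK ?lt0n.
exact: (conn_map (f := fun p => (p.1.-2, p.2.-1)) sub).
Qed.

(** The outside is deleted in two rounds: first the even bottom vertices and those beyond the right
    boundary, all pendant, then the odd bottom vertices, which become pendant by losing their
    horizontal edges. *)
Lemma drift_conn x y x' y' : tri n x y -> tri n x' y' ->
  conn (adj G) (x.+1, y.+1) (x'.+1, y'.+1) -> conn (adj d) (x, y) (x', y').
Proof.
rewrite /tri => xy xy'.
pose S := [pred p : nat * nat | (p.2 == 0) && ~~ odd p.1 || (4 * n < p.1 + p.2)].
pose S' := [pred p : nat * nat | p.2 == 0].
have [sh sv] := drift_supported.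
have horF a e : ~~ regh n a e -> hor G a e = false by move/negP=> h; apply/negP => /sh.
have verF a e : ~~ regv n a e -> ver G a e = false by move/negP=> h; apply/negP => /sv.
have Sp p : p \in S -> pendant (adj G) p.
  case: p => [a e]; rewrite inE /= => /orP[/andP[/eqP -> a_even]|ae]; apply: deg_pendant.
    rewrite /deg (verF a 0) // (horF a 0); last by rewrite /regh addn0 (negbTE a_even).
    case: a a_even => [|a]; first by lia.
    case: (leqP a.+1 (4 * n)) => [a_lt|a_ge] a_even.
      have i_lt : (a./2) < n.*2 by lia.
      have [_ _] := drift_bottom i_lt; have -> : (a./2).*2.+2 = a.+1 by lia.
      by move=> ->; lia.
    by rewrite (verF a.+1 1); [lia|rewrite /regv /reg; case: ifP; lia].
  rewrite /deg (horF a e); last by rewrite /regh /reg; case: ifP; lia.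
  rewrite (verF a e.+1); last by rewrite /regv /reg; case: ifP; lia.
  have [aeE|aeNE] := eqVneq (a + e) (4 * n).+1; last first.
    rewrite (horF a.-1 e); last by rewrite /regh /reg; case: ifP; lia.
    by rewrite (verF a e); [lia|rewrite /regv /reg; case: ifP; lia].
  case: (leqP a e) => [ae'|ea].
    rewrite (horF a.-1 e); last by rewrite /regh /reg; case: ifP; lia.
    by rewrite (verF a e); [lia|rewrite /regv /reg; case: ifP; lia].
  have j_lt : a - n.*2.+1 < n.*2 \/ e = 0 by lia.
  case: j_lt => [j_lt|e0]; last by rewrite e0 (verF a 0) //; lia.
  have [_ + + _ _] := drift_right_cell j_lt.
  have -> : n.*2 + (a - n.*2.+1) = a.-1 by lia.
  have -> : n.*2 - (a - n.*2.+1) = e by lia.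
  have -> : a.-1.+1 = a by lia.
  by move=> -> ->; case: (s _); lia.
have S_out a e : e <= a -> a + e <= 4 * n - 2 -> (a.+1, e.+1) \notin S.
  by move=> ? ?; rewrite inE /=; lia.
have Sp' p : p \in S' -> pendant (avoiding (adj G) S) p.
  case: p => [a e]; rewrite inE /= => /eqP ->.
  have uniq_nbr q : avoiding (adj G) S (a, 0) q -> q = (a, 1).
    rewrite /avoiding /= !inE; case: q => [a' e']; rewrite /adj /= => /and3P[h1 h2].
    case/or4P=> /andP[/eqP[? ?] _]; subst => //; try lia.
  by move=> q q' /uniq_nbr -> /uniq_nbr ->.
have [[yx xy1] [yx' xy1']] :
    (y <= x /\ x + y <= 4 * n - 2) /\ (y' <= x' /\ x' + y' <= 4 * n - 2) by lia.
move/(conn_avoiding (@adj_sym G) Sp (S_out _ _ yx xy1) (S_out _ _ yx' xy1')).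
have S'_out a e : (a.+1, e.+1) \notin S' by rewrite inE.
move/(conn_avoiding (avoiding_sym S (@adj_sym G)) Sp' (S'_out _ _) (S'_out _ _)).
have sub : forall p q, avoiding (avoiding (adj G) S) S' p q ->
    conn (adj d) (p.1.-1, p.2.-1) (q.1.-1, q.2.-1).
  move=> p q /and3P[p0 q0 /and3P[+ + pq]]; move: p q pq p0 q0.
  apply: adjW => [p q IH h1 h2 h3 h4|x0 y0 h|x0 y0 h].
  - exact: (conn_sym (@adj_sym _) (IH h2 h1 h4 h3)).
  - rewrite !inE /= => y_gt _ _ xy0; have := sh _ _ h; rewrite /regh /reg => rxy.
    have x_gt : 0 < x0 by move: rxy; case: ifP; lia.
    rewrite -{2}(prednK x_gt); apply/conn1/adj_hor.
    apply/andP; split; last by rewrite !prednK // lt0n.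
    by move: rxy; rewrite /has_hor /tri; case: ifP; lia.
  - rewrite !inE /= => y_gt _ _ xy0; have := sv _ _ h; rewrite /regv /reg => rxy.
    have x_gt : 0 < x0 by move: rxy; case: ifP; lia.
    have y_gt' : 0 < y0 by lia.
    rewrite -{2}(prednK y_gt'); apply/conn1/adj_ver.
    apply/andP; split; last by rewrite !prednK.
    by move: rxy; rewrite /has_ver /tri; case: ifP; lia.
exact: (conn_map (f := fun p => (p.1.-1, p.2.-1)) sub).
Qed.

Let Fsym := conn_sym (@adj_sym F).
Let Gsym := conn_sym (@adj_sym G).

Lemma conn_ext_drift p q : deg F p.1 p.2 <= 1 -> deg F q.1 q.2 <= 1 ->
  conn (adj F) p q -> conn (adj G) p q.
Proof.
move=> p1 q1 /(gyr_conn ext_deg2 ext_supported).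
by case: p q p1 q1 => [a e] [a' e'] p1 q1; rewrite !gyr_pt_id.
Qed.

Lemma conn_drift_ext p q : deg G p.1 p.2 <= 1 -> deg G q.1 q.2 <= 1 ->
  conn (adj G) p q -> conn (adj F) p q.
Proof.
move=> p1 q1 /(gyr_conn drift_deg2 drift_supported).
have [eh ev] := gyrK ext_supported.
move/(eq_conn eh ev); case: p q p1 q1 => [a e] [a' e'] p1 q1.
by rewrite !gyr_pt_id.
Qed.

Lemma ext_deg_left i : i < n.*2 -> deg F i.+1 i.+1 <= 1.
Proof.
have [sh sv] := ext_supported.
rewrite /deg hor_diag ver_diag succnK.
have -> : hor F i i.+1 = false.
  by apply/negP => /sh; rewrite /regh /reg; case: ifP; lia.
have -> : ver F i.+1 i.+2 = false.
  by apply/negP => /sv; rewrite /regv /reg; case: ifP; lia.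
by case: (r i); rewrite ?andbF /=; lia.
Qed.

Lemma ext_deg_right j : j < n.*2 -> ~~ tau.[j] -> deg F (n.*2 + j).+1 (n.*2 - j) <= 1.
Proof.
move=> j_lt tj; have [sh sv] := ext_supported.
rewrite /deg succnK ext_right_edge // (negbTE tj).
have -> : hor F (n.*2 + j).+1 (n.*2 - j) = false.
  by apply/negP => /sh; rewrite /regh /reg; case: ifP; lia.
have -> : ver F (n.*2 + j).+1 (n.*2 - j).+1 = false.
  by apply/negP => /sv; rewrite /regv /reg; case: ifP; lia.
by rewrite !addn0 add0n leq_b1.
Qed.

Lemma ext_deg_bottom i : deg F i.*2.+2 0 <= 1.
Proof. by rewrite /deg (_ : hor F _ 0 = false) // (_ : hor F _.-1 0 = false) ?leq_b1. Qed.

Lemma drift_deg_bottom i : i < n.*2 -> deg G i.*2.+2 0 <= 1.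
Proof.
move=> i_lt; have [_ _ h] := drift_bottom i_lt; have [sh sv] := drift_supported.
have h0 : hor G i.*2.+2 0 = false.
  by apply/negP => /sh; rewrite /regh /reg; case: ifP; lia.
have v0 : ver G i.*2.+2 0 = false by apply/negP => /sv.
by rewrite /deg h h0 v0 add0n !addn0 leq_b1.
Qed.

Lemma left_link i : i < n.*2 -> sigma.[i] ->
  exists k, [/\ k < n.*2, sigma1.[k] & adj F (i.+1, i.+1) (k.+2, k.+1)].
Proof.
move=> i_lt si; case ri: (r i); last first.
  exists i; split=> //; first by have := rhoS i_lt; rewrite ri si; case: sigma1.[_]; lia.
  by apply: adj_hor; rewrite hor_diag si ri.
case: i i_lt si ri => [_ _|i i_lt si ri]; first by rewrite rho0.
exists i; split; [lia| |].
  have := rhoS (ltnW i_lt); have /implyP := @rho_sigma i (ltnW i_lt).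
  by rewrite ri; case: sigma1.[_]; lia.
by rewrite adj_sym; apply: adj_ver; rewrite ver_diag si ri.
Qed.

Lemma left_link1 i : i < n.*2 -> sigma1.[i] ->
  exists k, [/\ k < n.*2, sigma.[k] & adj F (k.+1, k.+1) (i.+2, i.+1)].
Proof.
move=> i_lt si; have := rhoS i_lt; rewrite si; case ri: (r i.+1) => rS.
  have iS : i.+1 < n.*2.
    by rewrite ltn_neqAle i_lt andbT; apply: contraTneq ri => ->; rewrite rho_last.
  exists i.+1; split=> //; first exact: rho_sigma.
  by rewrite adj_sym; apply: adj_ver; rewrite ver_diag ri (rho_sigma iS ri).
exists i; split=> //; first by move: rS; case: sigma.[_]; lia.
by apply: adj_hor; rewrite hor_diag; move: rS; case: (r i); case: sigma.[_]; lia.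
Qed.

(** The counterpart of [left_link] after gyration: one leftover edge joins the old right end of a
    path to its new right end. *)
Lemma right_link j : j < n.*2 -> ~~ tau.[j] ->
  exists k, [/\ k < n.*2, ~~ tau1.[k]
              & adj G ((n.*2 + j).+1, n.*2 - j) (n.*2 + k, n.*2 - k)].
Proof.
move=> j_lt tj; have [_ h v rel _] := drift_right_cell j_lt.
case sj: (s j.+1).
  have jS : j.+1 < n.*2.
    by rewrite ltn_neqAle j_lt andbT; apply: contraTneq sj => ->; rewrite left_edge_last.
  exists j.+1; split=> //; first by have [_ _ _ _ ->] := drift_right_cell jS.
  rewrite sj in v; have E : n.*2 - j = (n.*2 - j.+1).+1 by lia.
  by rewrite addnS adj_sym {1}E; apply: adj_ver; rewrite -E v.
exists j; split=> //; first by move: rel tj; rewrite sj; case: tau1.[_]; case: tau.[_]; lia.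
by rewrite adj_sym; apply: adj_hor; rewrite h tj sj.
Qed.

Lemma right_link1 j : j < n.*2 -> ~~ tau1.[j] ->
  exists k, [/\ k < n.*2, ~~ tau.[k]
              & adj G ((n.*2 + k).+1, n.*2 - k) (n.*2 + j, n.*2 - j)].
Proof.
move=> j_lt tj; have [_ h v rel _] := drift_right_cell j_lt.
case sj: (s j).
  case: j {h v rel} j_lt tj sj => [_ _|j jS tj sj]; first by rewrite left_edge0.
  have [_ _ v _ _] := drift_right_cell (ltnW jS); rewrite sj in v.
  exists j; split; first exact: ltnW.
    by have := bottom_left_edges (ltnW jS); rewrite sj; case: tau.[_]; lia.
  have E : n.*2 - j = (n.*2 - j.+1).+1 by lia.
  by rewrite addnS adj_sym {1}E; apply: adj_ver; rewrite -E v.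
move: rel; rewrite sj (negbTE tj) => rel; have {rel}[tj' sj'] : ~~ tau.[j] /\ ~~ s j.+1.
  by move: rel; case: (s _); case: tau.[_]; split; lia.
by exists j; split=> //; rewrite adj_sym; apply: adj_hor; rewrite h tj' sj'.
Qed.

Lemma left_right_conn i j : i < n.*2 -> j < n.*2 ->
  conn (adj c) (left_vertex i) (right_vertex n j) ->
  conn (adj F) (i.+2, i.+1) ((n.*2 + j).+1, n.*2 - j).
Proof.
move=> i_lt j_lt /conn_ext /=; have -> : (n.*2.-1 + j).+2 = (n.*2 + j).+1 by lia.
by have -> : (n.*2.-1 - j).+1 = n.*2 - j by lia.
Qed.

Lemma drift_left_right_conn i j : i < n.*2 -> j < n.*2 ->
  conn (adj G) (i.+1, i.+1) (n.*2 + j, n.*2 - j) ->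
  conn (adj d) (left_vertex i) (right_vertex n j).
Proof.
move=> i_lt j_lt ij; apply: drift_conn; rewrite /tri; [lia|lia|].
have -> : (n.*2.-1 + j).+1 = n.*2 + j by lia.
by have -> : (n.*2.-1 - j).+1 = n.*2 - j by lia.
Qed.

Lemma ext_bottom_conn i : i < n.*2 -> conn (adj F) (i.*2.+2, 0) (i.*2.+2, 1).
Proof.
by move=> i_lt; apply/conn1/adj_ver; rewrite ver_ext // (spec_external cS).
Qed.

Lemma drift_bottom_conn i : i < n.*2 -> conn (adj G) (i.*2.+2, 0) (i.*2.+1, 1).
Proof.
move=> i_lt; have [v h _] := drift_bottom i_lt.
apply: (conn_trans (q := (i.*2.+1, 0))); last by apply/conn1/adj_ver.
by apply/Gsym/conn1/adj_hor.
Qed.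

(** The foot [(i.*2.+2, 0)] of the old external edge has degree at most 1 before and after gyration,
    hence is fixed, and it is linked to the i-th external vertex on both sides. *)
Lemma drift_matching i j : i < n.*2 -> j < n.*2 ->
  conn (adj d) (i.*2, 0) (j.*2, 0) <-> conn (adj c) (i.*2, 0) (j.*2, 0).
Proof.
move=> i_lt j_lt; split=> ij.
  apply: ext_conn => //; apply: conn_trans (ext_bottom_conn j_lt).
  apply: conn_trans (Fsym (ext_bottom_conn i_lt)) _.
  apply: conn_drift_ext; try exact: drift_deg_bottom.
  apply: conn_trans (drift_bottom_conn i_lt) _; apply: conn_trans (conn_drift_pt ij) _.
  exact/Gsym/drift_bottom_conn.
apply: drift_conn; rewrite /tri; [lia|lia|].
apply: conn_trans (drift_bottom_conn j_lt).
apply: conn_trans (Gsym (drift_bottom_conn i_lt)) _.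
apply: conn_ext_drift; try exact: ext_deg_bottom.
apply: conn_trans (ext_bottom_conn i_lt) _; apply: conn_trans (conn_ext ij) _.
exact/Fsym/ext_bottom_conn.
Qed.

Lemma hor_drift x y : hor d x y = has_hor n x y && hor G x.+1 y.+1.
Proof. by []. Qed.

Lemma ver_drift x y : ver d x y = has_ver n x y && ver G x.+1 y.+1.
Proof. by []. Qed.

Lemma drift_spec : tfpl_spec d sigma tau1 pi.
Proof.
split.
- by split=> x y /andP[].
- move=> i i_lt; have [h _ _] := drift_bottom i_lt.
  by apply/andP; split=> //; rewrite /has_ver /tri; lia.
- move=> x y yx xy; have xy_in : inner n x.+1 y.+1 by rewrite /inner; lia.
  rewrite -(drift_deg xy_in) /deg succnK ltn0Sn.
  have vF : y = 0 -> odd x -> ver G x.+1 y.+1 = false.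
    move=> -> x_odd; have x_lt : x./2 < n.*2 by lia.
    have [_ _] := drift_bottom x_lt.
    by have -> : x./2.*2.+2 = x.+1 by lia.
  have -> : hor d x y = hor G x.+1 y.+1.
    by rewrite hor_drift; have -> : has_hor n x y by rewrite /has_hor /tri; lia.
  have -> : (0 < x) && hor d x.-1 y = hor G x y.+1.
    have x_gt : 0 < x by lia.
    by rewrite hor_drift x_gt prednK //; have -> : has_hor n x.-1 y by rewrite /has_hor /tri; lia.
  have -> : ver d x y.+1 = ver G x.+1 y.+2.
    by rewrite ver_drift; have -> : has_ver n x y.+1 by rewrite /has_ver /tri; lia.
  have -> // : ver d x y = ver G x.+1 y.+1.
  rewrite ver_drift; case hv: (has_ver n x y) => //; apply/esym/vF.
    by move: hv; rewrite /has_ver /tri; lia.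
  by move: hv; rewrite /has_ver /tri; lia.
- move=> i i_lt; have i_lt' : i < n.*2 by lia.
  have [h _] := drift_left i_lt'.
  by apply/andP; split; [rewrite /has_hor /tri; lia|rewrite h].
- move=> i /andP[i_gt i_lt]; have [_ v] := drift_left i_lt.
  by rewrite ver_drift v; have -> : has_ver n i i by rewrite /has_ver /tri; lia.
- move=> j /andP[j_gt j_lt]; have j_lt' : j.-1 < n.*2 by lia.
  have [h _ _ _ _] := drift_right_cell j_lt'.
  apply/andP; split; first by rewrite /has_hor /tri; lia.
  have -> : (n.*2.-1 + j).-1.+1 = n.*2 + j.-1 by lia.
  by have -> : (n.*2.-1 - j).+1 = n.*2.-1 - j.-1 by lia.
- move=> j j_lt; rewrite nth_drift_right; last by lia.
  rewrite ver_drift; have -> : has_ver n (n.*2.-1 + j) (n.*2.-1 - j).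
    by rewrite /has_ver /tri; lia.
  have -> : (n.*2.-1 + j).+1 = n.*2 + j by lia.
  by have -> : (n.*2.-1 - j).+1 = n.*2 - j by lia.
- move=> i i_lt /(left_link i_lt)[k [k_lt sk ik]].
  have [j [j_lt tj kj]] := spec_left_path cS k_lt sk.
  have [l [l_lt tl jl]] := right_link j_lt tj.
  exists l; split=> //; apply: drift_left_right_conn => //.
  apply: conn_trans (conn1 jl); apply: conn_ext_drift;
    [exact: ext_deg_left|exact: ext_deg_right|].
  exact: conn_trans (conn1 ik) (left_right_conn k_lt j_lt kj).
- move=> j j_lt /(right_link1 j_lt)[l [l_lt tl lj]].
  have [k [k_lt sk kl]] := spec_right_path cS l_lt tl.
  have [i [i_lt si ik]] := left_link1 k_lt sk.
  exists i; split=> //; apply: drift_left_right_conn => //.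
  apply: conn_trans (conn1 lj); apply: conn_ext_drift;
    [exact: ext_deg_left|exact: ext_deg_right|].
  exact: conn_trans (conn1 ik) (left_right_conn k_lt l_lt kl).
- by move=> i j ij; rewrite drift_matching // (spec_matching cS).
Qed.

(** The conjugate word is the left boundary of the reflected drift, to which [spec_balanced]
    applies. *)
Lemma drift_right_dyck : tau1 \in dyck n.
Proof.
rewrite -conjugate_dyck inE.
have l_lt : n.*2.-1 < n.*2 by lia.
have := spec_balanced n_gt0 (refl_spec n_gt0 drift_spec); apply.
- by rewrite size_tuple.
- by rewrite nth_conjugate ?subn0 ?drift_right_last //; lia.
- have := @ones_rev_negb tau1 n.*2; rewrite size_tuple leqnn subnn ones0 => /(_ isT).
  by rewrite ones_drift_right_last /=; lia.
Qed.

Lemma drift_right_arrow : arrow (conjugate tau) (conjugate tau1).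
Proof.
apply/arrow_conjugateP => //; first exact: drift_right_dyck.
move=> i i_le; rewrite ones_drift_right //; split; first by case: (s i); lia.
case: i i_le => // i i_lt _ sE; have si : s i.+1 by move: sE; case: (s i.+1); lia.
by have := bottom_left_edges i_lt; rewrite si /=; case: tau.[_]; lia.
Qed.

Lemma ext_left_edgeE j : j <= n.*2 ->
  s j = (ones tau1 j != ones tau j).
Proof.
move=> j_le; rewrite ones_drift_right //; move: (ones tau j) (s j) => k b'.
by case: b'; lia.
Qed.

(** With [ver_gyr_ext], this recovers the gyrated configuration from the drift: the bottom row is
    full, and the edges beyond the right boundary depend on [tau] and [tau1] alone. *)
Lemma hor_gyr_ext x y : hor G x y = regh n x y &&
  [|| y == 0,
      [&& x + y == 4 * n, ~~ tau.[x - n.*2]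
        & ones tau1 (x - n.*2).+1 == ones tau (x - n.*2).+1]
    | (0 < y) && hor d x.-1 y.-1].
Proof.
have [sh _] := gyr_supported n F.
case: (boolP (regh n x y)) => [rxy|rF]; last by apply/negbTE; apply: contraNN rF => /sh.
case: (posnP y) rxy => [->|y_gt] rxy.
  have x_lt : x./2 < n.*2 by move: rxy; rewrite /regh /reg; case: ifP; lia.
  have [_ + _] := drift_bottom x_lt.
  have -> : x./2.*2.+1 = x by move: rxy; rewrite /regh; case: ifP; lia.
  by [].
have x_gt : 0 < x by move: rxy; rewrite /regh /reg; case: ifP; lia.
rewrite hor_drift !prednK // -/F -/G.
have [xyE|xyN] := eqVneq (x + y) (4 * n).
  have j_lt : x - n.*2 < n.*2 by move: rxy; rewrite /regh /reg; case: ifP; lia.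
  have [_ + _ _ _] := drift_right_cell j_lt.
  rewrite ext_left_edgeE // negbK.
  have -> : n.*2 + (x - n.*2) = x by move: rxy; rewrite /regh /reg; case: ifP; lia.
  have -> : n.*2 - (x - n.*2) = y by move: rxy; rewrite /regh /reg; case: ifP; lia.
  rewrite -/F -/G => <-; have -> : has_hor n x.-1 y.-1 = false; last by rewrite orbF.
  by rewrite /has_hor /tri; lia.
have -> // : has_hor n x.-1 y.-1.
by move: rxy; rewrite /has_hor /tri /regh /reg; case: ifP; lia.
Qed.

Lemma ver_gyr_ext x y : ver G x y = regv n x y &&
  ((x + y == (4 * n).+1) &&
      (ones tau1 (x - n.*2) != ones tau (x - n.*2))
    || ver d x.-1 y.-1).
Proof.
have [_ sv] := gyr_supported n F.
case: (boolP (regv n x y)) => [rxy|rF]; last by apply/negbTE; apply: contraNN rF => /sv.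
have y_gt : 0 < y by case/andP: rxy.
have x_gt : 0 < x by move: rxy; rewrite /regv /reg; case: ifP; lia.
rewrite ver_drift !prednK // -/F -/G.
have [xyE|xyN] := eqVneq (x + y) (4 * n).+1.
  have j_lt : x - n.*2.+1 < n.*2 by move: rxy; rewrite /regv /reg; case: ifP; lia.
  have [_ _ + _ _] := drift_right_cell j_lt.
  rewrite ext_left_edgeE //.
  have -> : (x - n.*2.+1).+1 = x - n.*2 by move: rxy; rewrite /regv /reg; case: ifP; lia.
  have -> : (n.*2 + (x - n.*2.+1)).+1 = x by move: rxy; rewrite /regv /reg; case: ifP; lia.
  have -> : n.*2 - (x - n.*2.+1) = y by move: rxy; rewrite /regv /reg; case: ifP; lia.
  rewrite -/F -/G => <-; have -> : has_ver n x.-1 y.-1 = false; last by rewrite orbF.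
  by rewrite /has_ver /tri; lia.
case: (boolP (has_ver n x.-1 y.-1)) => // hF.
have [yE x_even] : y = 1 /\ ~~ odd x.
  by move: rxy hF; rewrite /has_ver /tri /regv /reg; case: ifP; lia.
have x_lt : x./2.-1 < n.*2.
  by move: rxy; rewrite /regv /reg; case: ifP; lia.
have [_ _] := drift_bottom x_lt.
by have -> : x./2.-1.*2.+2 = x by [lia]; rewrite yE.
Qed.

End Drift.

(** * Counting *)

(** Equal data give equal gyrated configurations; gyrating again gives equal extended ones, which
    contain [c1] and [c2]. *)
Lemma drift_inj (n : nat) (sigma s1 s2 tau pi : n.*2.-tuple bool) (c1 c2 : config) :
  0 < n -> sigma \in dyck n -> s1 \in dyck n -> s2 \in dyck n -> tau \in dyck n ->
  ones_step n sigma s1 -> ones_step n sigma s2 ->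
  tfpl_spec c1 s1 tau pi -> tfpl_spec c2 s2 tau pi ->
  drift_right sigma s1 c1 = drift_right sigma s2 c2 ->
  hor (drift_config sigma s1 c1) =2 hor (drift_config sigma s2 c2) ->
  ver (drift_config sigma s1 c1) =2 ver (drift_config sigma s2 c2) ->
  hor c1 =2 hor c2 /\ ver c1 =2 ver c2.
Proof.
move=> n_gt0 sD s1D s2D tD st1 st2 cS1 cS2 tE hE vE.
pose F1 := ext_config sigma s1 c1; pose F2 := ext_config sigma s2 c2.
have GhE : hor (gyr n F1) =2 hor (gyr n F2).
  move=> x y; rewrite (hor_gyr_ext n_gt0 sD s1D tD st1 cS1).
  by rewrite (hor_gyr_ext n_gt0 sD s2D tD st2 cS2) tE hE.
have GvE : ver (gyr n F1) =2 ver (gyr n F2).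
  move=> x y; rewrite (ver_gyr_ext n_gt0 sD s1D tD st1 cS1).
  by rewrite (ver_gyr_ext n_gt0 sD s2D tD st2 cS2) tE vE.
have gyr_eq (a b : config) : hor a =2 hor b -> ver a =2 ver b ->
    hor (gyr n a) =2 hor (gyr n b) /\ ver (gyr n a) =2 ver (gyr n b).
  by move=> eh ev; split=> x y; rewrite /= /parallel !eh !ev.
have [hF vF] := gyr_eq _ _ GhE GvE.
have [h1 v1] := gyrK (ext_supported n_gt0 sD s1D tD cS1).
have [h2 v2] := gyrK (ext_supported n_gt0 sD s2D tD cS2).
split=> x y; case: (leqP y x) => yx.
- by rewrite -(hor_ext sigma s1 c1 yx) -(hor_ext sigma s2 c2 yx) -h1 -h2 hF.
- by rewrite (spec_horF n_gt0 cS1) ?(spec_horF n_gt0 cS2) ?yx.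
- by rewrite -(ver_ext sigma s1 c1 yx) -(ver_ext sigma s2 c2 yx) -v1 -v2 vF.
- by rewrite (spec_verF n_gt0 cS1) ?(spec_verF n_gt0 cS2) ?yx.
Qed.

Section Counting.

Variable n : nat.
Hypothesis n_gt0 : 0 < n.
Implicit Types sigma tau pi : n.*2.-tuple bool.

Definition left_pairs sigma tau pi : {set n.*2.-tuple bool * {set edge n}} :=
  [set p | [&& p.1 \in dyck n, arrow sigma p.1 & is_tfpl p.2 p.1 tau pi]].

Definition right_pairs sigma tau pi : {set n.*2.-tuple bool * {set edge n}} :=
  [set p | [&& p.1 \in dyck n, arrow (conjugate tau) (conjugate p.1)
             & is_tfpl p.2 sigma p.1 pi]].

Lemma sum_tfpl_number (P : pred (n.*2.-tuple bool))
    (Q : n.*2.-tuple bool -> {set edge n} -> bool) :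
  \sum_(w | P w) #|[set f | Q w f]| = #|[set p | P p.1 && Q p.1 p.2]|.
Proof.
rewrite -sum1dep_card (eq_bigr (fun w => \sum_(f | Q w f) 1)); last first.
  by move=> w _; rewrite sum1dep_card.
by rewrite pair_big_dep.
Qed.

Lemma card_left_pairs sigma tau pi :
  \sum_(w in dyck n | arrow sigma w) tfpl_number w tau pi = #|left_pairs sigma tau pi|.
Proof.
rewrite (sum_tfpl_number _ (fun w f => is_tfpl f w tau pi)).
by congr #|pred_of_set _|; apply/setP => p; rewrite !inE andbA.
Qed.

Lemma card_right_pairs sigma tau pi :
  \sum_(w in dyck n | arrow (conjugate tau) (conjugate w)) tfpl_number sigma w pi =
  #|right_pairs sigma tau pi|.
Proof.
rewrite (sum_tfpl_number _ (fun w f => is_tfpl f sigma w pi)).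
by congr #|pred_of_set _|; apply/setP => p; rewrite !inE andbA.
Qed.

Definition drift sigma (p : n.*2.-tuple bool * {set edge n}) :
    n.*2.-tuple bool * {set edge n} :=
  (drift_right sigma p.1 (config_of p.2),
   edge_set n (drift_config sigma p.1 (config_of p.2))).

Lemma config_of_drift sigma s c :
  hor (config_of (edge_set n (drift_config sigma s c))) =2 hor (drift_config sigma s c) /\
  ver (config_of (edge_set n (drift_config sigma s c))) =2 ver (drift_config sigma s c).
Proof.
split=> x y;
  have [Eh Ev] := config_of_edge_set n_gt0 (drift_config sigma s c) x y.
  by rewrite Eh hor_drift andbA andbb.
by rewrite Ev ver_drift andbA andbb.
Qed.

Lemma left_pairsP sigma tau pi s f : sigma \in dyck n ->
  (s, f) \in left_pairs sigma tau pi <->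
  [/\ s \in dyck n, ones_step n sigma s, {in f, forall e, is_edge e}
    & tfpl_spec (config_of f) s tau pi].
Proof.
move=> sD; rewrite in_set /=; split.
  by case/and3P=> s1D /arrowP h /(tfplP _ _ _ _ n_gt0)[fE fS]; split=> //; exact: h.
case=> s1D h fE fS; apply/and3P; split=> //; first exact/arrowP.
exact/(tfplP _ _ _ _ n_gt0).
Qed.

Lemma leq_left_right_pairs sigma tau pi :
  sigma \in dyck n -> tau \in dyck n ->
  #|left_pairs sigma tau pi| <= #|right_pairs sigma tau pi|.
Proof.
move=> sD tD; rewrite -(card_in_imset (f := drift sigma)).
  apply/subset_leq_card/subsetP => _ /imsetP[[s f] /left_pairsP[//|s1D st fE fS] ->].
  rewrite in_set /=; apply/and3P; split.
  - exact: (drift_right_dyck n_gt0 sD s1D tD st fS).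
  - exact: (drift_right_arrow n_gt0 sD s1D tD st fS).
  apply/(tfplP _ _ _ _ n_gt0); split; first exact: edge_set_edges.
  have [hE vE] := config_of_drift sigma s (config_of f).
  by apply: spec_eq (drift_spec n_gt0 sD s1D tD st fS) => x y.
move=> [s1 f1] [s2 f2] /left_pairsP[//|s1D st1 f1E f1S] /left_pairsP[//|s2D st2 f2E f2S].
move=> E; have [tE gE] := (congr1 fst E, congr1 snd E).
have [h1 v1] := config_of_drift sigma s1 (config_of f1).
have [h2 v2] := config_of_drift sigma s2 (config_of f2).
have [hE vE] : hor (config_of f1) =2 hor (config_of f2) /\
    ver (config_of f1) =2 ver (config_of f2).
  refine (drift_inj n_gt0 sD s1D s2D tD st1 st2 f1S f2S tE _ _) => x y.
    by rewrite -h1 -h2 [edge_set n _]gE.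
  by rewrite -v1 -v2 [edge_set n _]gE.
congr pair; last exact: config_of_inj.
(* The left word is read off the vertical edges of the left boundary. *)
apply: eq_from_tnth => i; rewrite !(tnth_nth false).
apply: negb_inj.
rewrite -(left_ver_spec n_gt0 f1S (dyck_first n_gt0 s1D)) //.
by rewrite -(left_ver_spec n_gt0 f2S (dyck_first n_gt0 s2D)).
Qed.

Lemma leq_right_left_pairs sigma tau pi :
  #|right_pairs sigma tau pi| <=
  #|left_pairs (conjugate tau) (conjugate sigma) (conjugate pi)|.
Proof.
rewrite -(card_in_imset (f := fun p => (conjugate p.1, refl_set p.2))).
  apply/subset_leq_card/subsetP => _ /imsetP[[t g] + ->]; rewrite !in_set /=.
  by case/and3P=> tD ts gS; rewrite balanced_rev_negb tD ts refl_tfpl.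
move=> [t1 g1] [t2 g2]; rewrite !in_set /=.
case/and3P=> _ _ /(tfplP _ _ _ _ n_gt0)[g1E _].
case/and3P=> _ _ /(tfplP _ _ _ _ n_gt0)[g2E _] E.
have [tE gE] := (congr1 fst E, congr1 snd E).
congr pair; first exact: (inv_inj (@conjugateK n)) tE.
exact: (refl_set_inj n_gt0 g1E g2E gE).
Qed.

End Counting.

Theorem theorem3p1 (n : nat) (hn : 0 < n) (sigma tau pi : n.*2.-tuple bool)
    (hsigma : sigma \in dyck n) (htau : tau \in dyck n) (hpi : pi \in dyck n) :
  \sum_(sigma1 in dyck n | arrow sigma sigma1) tfpl_number sigma1 tau pi =
  \sum_(tau1 in dyck n | arrow (conjugate tau) (conjugate tau1)) tfpl_number sigma tau1 pi.
Proof.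
rewrite card_left_pairs card_right_pairs; apply/eqP.
rewrite eqn_leq leq_left_right_pairs //=.
(* The right pairs number at most the left pairs of the mirror image, these at most its right pairs,
   and those at most the original left pairs. *)
have := leq_right_left_pairs hn (conjugate tau) (conjugate sigma) (conjugate pi).
rewrite !conjugateK; apply: leq_trans.
apply: leq_trans (leq_right_left_pairs hn _ _ _) _.
by apply: leq_left_right_pairs; rewrite ?conjugate_dyck.
Qed.
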